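(* Let $V:[0,\infty)\to\mathbb{R}$ be a càdlàg function with finite variation on every compact interval, and fix $t>0$. Then for Lebesgue-almost every $x\in\mathbb{R}$ the sets $(0,t]\cap\mathcal{I}(x)$ and $(0,t]\cap\mathcal{D}(x)$ are finite, so that $\ell^x(t)$ and $\lambda^x(t)$ are well defined. The functions $x\mapsto \ell^x(t)$ and $x\mapsto\lambda^x(t)$ are measurable and Lebesgue integrable, and for every Borel set $A\subseteq\mathbb{R}$, $$\theta_t(A)=\int_A \ell^x(t)\,{\rm d}x,\qquad \vartheta_t(A)=\int_A \lambda^x(t)\,{\rm d}x .$$ That is, $\theta_t({\rm d}x)=\ell^x(t)\,{\rm d}x$ and $\vartheta_t({\rm d}x)=\lambda^x(t)\,{\rm d}x$.
   Context: Let $V:[0,\infty)\to\mathbb{R}$ be càdlàg (right-continuous with left limits) with finite variation on compact intervals. Write $V(s-)$ for the left limit and $\Delta V(s)=V(s)-V(s-)$. The discontinuous part is $V^d(t)=\sum_{0<s\le t}\Delta V(s)$ (an absolutely convergent series), and the continuous part is $V^c=V-V^d$. Then $V^c$ is continuous with finite variation. $V^c({\rm d}s)$ denotes its signed Stieltjes measure and $|V^c({\rm d}s)|$ its total variation measure. For $t>0$ and Borel $A\subseteq\mathbb{R}$ define the signed occupation measure $\theta_t(A)=\int_0^t \mathbf{1}_A(V(s))\,V^c({\rm d}s)$ and the absolute occupation measure $\vartheta_t(A)=\int_0^t\mathbf{1}_A(V(s))\,|V^c({\rm d}s)|$. For $x\in\mathbb{R}$ and $t>0$, we say $V$ increases through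 level $x$ at time $t$, and write $t\in\mathcal{I}(x)$, if two conditions hold. First, $V(t)=x$ and $V$ is continuous at $t$. Second, there is $\delta>0$ such that for all $s\ge0$ with $0<|s-t|<\delta$, $V(s)-V(t)$ has the same (strict) sign as $s-t$. We say $V$ decreases through level $x$ at time $t$, written $t\in\mathcal{D}(x)$, if $-V$ increases through level $-x$ at time $t$. Define $\ell^x(t)=\mathrm{Card}((0,t]\cap\mathcal{I}(x))-\mathrm{Card}((0,t]\cap\mathcal{D}(x))$ and $\lambda^x(t)=\mathrm{Card}((0,t]\cap\mathcal{I}(x))+\mathrm{Card}((0,t]\cap\mathcal{D}(x))$, whenever these cardinalities are finite. *)

(* Defs.v *)
From HB Require Import structures.
From mathcomp Require Import all_boot all_order all_algebra.
From mathcomp Require Import all_classical all_reals all_analysis.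

Set Implicit Arguments.
Unset Strict Implicit.
Unset Printing Implicit Defensive.
Import Order.TTheory GRing.Theory Num.Def Num.Theory.
Import numFieldTopology.Exports.

Local Open Scope classical_set_scope.
Local Open Scope ring_scope.

Section Defs.
Context {R : realType}.

(** V : [0,oo) -> R is modelled as V : R -> R; only its values on [0,oo)
    are ever used. *)

Definition cadlag (V : R -> R) : Prop :=
  (forall s, 0 <= s -> V x @[x --> s^'+] --> V s) /\
  (forall s, 0 < s -> exists l : R, V x @[x --> s^'-] --> l).

Definition finite_variation (V : R -> R) : Prop :=
  forall b, 0 <= b -> bounded_variation 0 b V.

Definition left_lim (V : R -> R) (s : R) : R := lim (V x @[x --> s^'-]).
Definition jump (V : R -> R) (s : R) : R := V s - left_lim V s.

(** V^d(t) = sum_{0<s<=t} Delta V(s)  (absolutely convergent series):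
    positive part minus negative part, each as a (nonnegative) esum. *)
Definition Vdisc (V : R -> R) (t : R) : R :=
  fine (\esum_(s in [set s : R | (0 < s <= t)%R]) (Num.max (jump V s) 0)%:E)%E
  - fine (\esum_(s in [set s : R | (0 < s <= t)%R]) (Num.max (- jump V s) 0)%:E)%E.

Definition Vcont (V : R -> R) (s : R) : R := V s - Vdisc V s.

(** Lebesgue-Stieltjes measure of a nondecreasing right-continuous F : R -> R
    (the library's [lebesgue_stieltjes_measure]); the zero measure if F is
    not nondecreasing and right-continuous (never used in that case). *)
Definition LSmeasure (F : R -> R) : set (measurableTypeR R) -> \bar R :=
  match pselect (nondecreasing F /\ (forall x, F y @[y --> x^'+] --> F x)) with
  | left H =>
      lebesgue_stieltjes_measure
        (HB.pack F (isCumulative.Build R _ R F (proj1 H) (proj2 H)))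
  | right _ => fun _ => 0%E
  end.

(** Total variation function of V^c on [0, s] (extended by its value at 0,
    i.e. 0, for s < 0) and the Jordan decomposition V^c = P - N (up to the
    constant V^c(0)), with P, N given by the library's pos_tv / neg_tv. *)
Definition TVcont (V : R -> R) (s : R) : R :=
  fine (total_variation 0 (Num.max s 0) (Vcont V)).
Definition Pcont (V : R -> R) (s : R) : R := fine (pos_tv 0 (Vcont V) (Num.max s 0)).
Definition Ncont (V : R -> R) (s : R) : R := fine (neg_tv 0 (Vcont V) (Num.max s 0)).

Definition occ_set (V : R -> R) (t : R) (A : set R) : set R :=
  [set s | 0 < s <= t /\ A (V s)].

(** signed occupation measure theta_t(A) = int_0^t 1_A(V s) V^c(ds)
    = mu_P({s in (0,t] | V s in A}) - mu_N({s in (0,t] | V s in A}) *)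
Definition theta (V : R -> R) (t : R) (A : set R) : \bar R :=
  (LSmeasure (Pcont V) (occ_set V t A) - LSmeasure (Ncont V) (occ_set V t A))%E.

(** absolute occupation measure vartheta_t(A) = int_0^t 1_A(V s) |V^c(ds)| *)
Definition vartheta (V : R -> R) (t : R) (A : set R) : \bar R :=
  LSmeasure (TVcont V) (occ_set V t A).

Definition increases_through (V : R -> R) (x t : R) : Prop :=
  [/\ V t = x, {for t, continuous V} &
      exists2 d, 0 < d & forall s, 0 <= s -> 0 < `|s - t| < d ->
        Num.sg (V s - V t) = Num.sg (s - t)].

Definition decreases_through (V : R -> R) (x t : R) : Prop :=
  increases_through (fun s => - V s) (- x) t.

Definition Iset (V : R -> R) (x t : R) : set R :=
  [set s | 0 < s <= t /\ increases_through V x s].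
Definition Dset (V : R -> R) (x t : R) : set R :=
  [set s | 0 < s <= t /\ decreases_through V x s].

(** cardinality of a finite set of reals (a finitely supported sum of 1's;
    its value is 0 for infinite sets, which only matters on a null set). *)
Definition card_fin (S : set R) : R := (\sum_(s \in S) (1 : R))%R.

Definition ell (V : R -> R) (x t : R) : R := card_fin (Iset V x t) - card_fin (Dset V x t).
Definition lam (V : R -> R) (x t : R) : R := card_fin (Iset V x t) + card_fin (Dset V x t).

End Defs.

(** measurability w.r.t. the Lebesgue (completed) sigma-algebra on the
    domain and the Borel sigma-algebra on the codomain: the domain type of
    [completed_lebesgue_measure]. *)
Definition lebesgue_measurable_fun {R : realType} (f : R -> R) : Prop :=
  measurable_fun (T := caratheodory_type (R:=R) (wlength (R:=R) idfun)^*%mu)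
    (U := R) setT f.

(* Main.v *)
Require Import Defs.
From HB Require Import structures.
From mathcomp Require Import all_boot all_order all_algebra.
From mathcomp Require Import finmap ring lra zify.
From mathcomp Require Import all_classical all_reals all_analysis.
From mathcomp Require Import measurable_realfun.
Import Order.TTheory GRing.Theory Num.Def Num.Theory.
Import numFieldNormedType.Exports.
Set Implicit Arguments.
Unset Strict Implicit.
Unset Printing Implicit Defensive.
Local Open Scope classical_set_scope.
Local Open Scope ring_scope.

(** A level [x] is crossed by [V] at time [s] when [V - x] has constant strict
    signs on both sides of [s], and these signs differ.  The argument counts
    crossings and integrates the count over the levels.

    - Cutting [[a, b]] into [n] cells, the number of cells whose endpoints lie on
      opposite sides of [x] has integral over [x] at most the total variation
      of [V] on [[a, b]].  By Fatou, for almost every [x] it does not tend to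
      infinity with [n]; together with the countability of the set of local
      extremal values this gives one-sided strict signs at every time.  Then
      crossings are locally finite, upward ones minus downward ones in [(a, b]]
      telescope to [1_(x < V b) - 1_(x < V a)], and both counts are limits of
      cell counts.

    - Hence [M_e(B) = \int #{crossings in B of direction e} dx] are measures
      with [(M_up - M_down)((a, b]) = V b - V a] and
      [(M_up + M_down)((a, b]) <= TV(V; a, b)].  Their atoms are the positive
      and negative parts of the jumps of [V].  Off the jump times their
      difference is the increment of [Vcont V] and, since
      [TV(V) <= TV(Vcont V) + TV(Vdisc V)], their sum is its total variation.

    - So off the jump times [M_up] and [M_down] are the Stieltjes measures of
      [Pcont V] and [Ncont V].  Evaluating them on [{s in (0, t] | V s \in A}]
      gives the theorem, because a crossing of [x] at a continuity point [s]
      has [V s = x]. *)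

(** * One-sided signs and crossings *)

(** Compactness of [[a, b]] in supremum form: the supremum of the [y] with [P a y] has this property
    itself, by locality and concatenation, and below [b] the same two facts would push it further
    right. *)
Lemma cousin (R : realType) (P : R -> R -> Prop) (a b : R) : a <= b ->
  (forall c d e, a <= c -> c <= d -> d <= e -> e <= b -> P c d -> P d e -> P c e) ->
  (forall s, a <= s <= b -> exists2 h, 0 < h & forall c d, a <= c -> c <= s ->
     s <= d -> d <= b -> s - h < c -> d < s + h -> P c d) ->
  P a b.
Proof.
move=> ab Ptr Ploc.
pose E := [set y | a <= y <= b /\ P a y].
have Ea : E a.
  have [h h0 H] := Ploc a (eqbRL (andb_idr (fun _ => ab)) (lexx a)).
  split; first by rewrite lexx.
  by apply: H; rewrite ?lexx// ?ltrDl// gtrBl.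
have supE : has_sup E by split; [exists a|exists b => y [/andP[]]].
set s := sup E.
have sa : a <= s by apply: ub_le_sup => //; exact: supE.2.
have sb : s <= b by apply: ge_sup => [|y [/andP[]]//]; exists a.
have sab : a <= s <= b by rewrite sa.
have [h h0 H] := Ploc s sab.
have [y [/andP[ay yb] Py] hy] := @sup_adherent _ E h h0 supE.
have ys : y <= s by apply: ub_le_sup; [exact: supE.2|split; rewrite ?ay].
have Pd d : s <= d -> d <= b -> d < s + h -> P a d.
  by move=> sd db dh; apply: (Ptr _ y) => //; [exact: le_trans sd|exact: H].
have [->|sb'] := eqVneq b s; first by apply: Pd; rewrite ?ltrDl.
have ltsb : s < b by rewrite lt_neqAle eq_sym sb' sb.
set d := minr b (s + h / 2).
have sd : s < d by rewrite lt_min ltsb ltrDl divr_gt0.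
have db : d <= b by rewrite ge_min lexx.
have dh : d < s + h.
  by rewrite gt_min ltrD2l gtr_pMr// invf_lt1// ltr1n orbT.
have Ed : E d by split; [rewrite db (le_trans sa (ltW sd))|exact: Pd (ltW sd) db dh].
have : d <= s by apply: ub_le_sup => //; exact: supE.2.
by rewrite leNgt sd.
Qed.

Section crossings.
Context {R : realType}.
Implicit Types (V : R -> R) (e : bool) (x s : R).

(** The direction [e] is [false] for "up" and [true] for "down". *)
Definition side e x y : bool := if e then y < x else x < y.

Definition right_side V e x s :=
  exists2 d, 0 < d & forall r, s < r < s + d -> side e x (V r).

(** The bound [d <= s] keeps the window inside [[0, +oo)], where [V] is meaningful. *)
Definition left_side V e x s :=
  exists2 d, 0 < d <= s & forall r, s - d < r < s -> side e x (V r).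

(** The value [V s] is left free, so a jump over [x] is a crossing as well. *)
Definition crossing V e x : set R :=
  [set s | left_side V (~~ e) x s /\ right_side V e x s].

Definition one_sided V x :=
  (forall s, 0 <= s -> exists e, right_side V e x s) /\
  (forall s, 0 < s -> exists e, left_side V e x s).

Lemma sideN e x y : side e x y -> side (~~ e) x y = false.
Proof. by case: e => /= /ltW; rewrite leNgt => /negbTE. Qed.

Lemma side_neq e x y : y != x -> side (~~ e) x y = ~~ side e x y.
Proof. by case: e => /= yx; rewrite -leNgt lt_neqAle ?yx// eq_sym yx. Qed.

Lemma right_side_inj V e f x s : right_side V e x s -> right_side V f x s -> e = f.
Proof.
move=> [d d0 H] [d' d'0 H'].
set m := minr d d'; have m0 : 0 < m by rewrite lt_min d0.
have m2 : m / 2 < m by rewrite gtr_pMr// invf_lt1// ltr1n.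
have := H (s + m / 2); have := H' (s + m / 2).
rewrite !ltrDl !ltrD2l divr_gt0//= !(lt_le_trans m2) ?ge_min ?lexx ?orbT//.
move=> /(_ erefl) + /(_ erefl).
by case: e f {H H'} => -[]//= /ltW; rewrite leNgt => /negbTE ->.
Qed.

Lemma left_side_inj V e f x s : left_side V e x s -> left_side V f x s -> e = f.
Proof.
move=> [d /andP[d0 _] H] [d' /andP[d'0 _] H'].
set m := minr d d'; have m0 : 0 < m by rewrite lt_min d0.
have m2 : m / 2 < m by rewrite gtr_pMr// invf_lt1// ltr1n.
have := H (s - m / 2); have := H' (s - m / 2).
rewrite !gtrBl !ltrD2l !ltrN2 divr_gt0//= !(lt_le_trans m2) ?ge_min ?lexx ?orbT//.
move=> /(_ erefl) + /(_ erefl).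
by case: e f {H H'} => -[]//= /ltW; rewrite leNgt => /negbTE ->.
Qed.

Lemma right_side_itv V e x s d r : (forall r, s < r < s + d -> side e x (V r)) ->
  s < r < s + d -> right_side V e x r.
Proof.
move=> H /andP[sr rd]; exists (s + d - r); first by rewrite subr_gt0.
by move=> q /andP[rq qd]; apply: H; rewrite (lt_trans sr)//= (lt_le_trans qd)// subrKC.
Qed.

Lemma right_side_itvl V e x s d r : (forall r, s - d < r < s -> side e x (V r)) ->
  s - d < r < s -> right_side V e x r.
Proof.
move=> H /andP[sr rd]; exists (s - r); first by rewrite subr_gt0.
by move=> q /andP[rq]; rewrite subrKC => qs; apply: H; rewrite (lt_trans sr).
Qed.

Lemma left_side_itv V e x s d r : 0 <= s -> (forall r, s < r < s + d -> side e x (V r)) ->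
  s < r < s + d -> left_side V e x r.
Proof.
move=> s0 H /andP[sr rd]; exists (r - s).
  by rewrite subr_gt0 sr gerBl.
by move=> q /andP[]; rewrite subKr => sq qr; apply: H; rewrite sq (lt_trans qr).
Qed.

Lemma crossing_gt0 V e x s : crossing V e x s -> 0 < s.
Proof. by move=> [[d /andP[d0 ds] _] _]; exact: lt_le_trans ds. Qed.

Lemma side_right V e x s : V y @[y --> s^'+] --> V s -> side e x (V s) ->
  exists2 h, 0 < h & forall r, s <= r < s + h -> side e x (V r).
Proof.
move=> Vs es; suff [h h0 H] : right_side V e x s.
  exists h => // r /andP[]; rewrite le_eqVlt => /predU1P[<-//|sr rh].
  by apply: H; rewrite sr.
case: e es => /= es.
  have /cvgr_lt /(_ _ es) [h /= h0 H] := Vs.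
  exists h => // r /andP[sr rh]; apply: H => //=.
  by rewrite ltr_distl; apply/andP; split; lra.
have /cvgr_gt /(_ _ es) [h /= h0 H] := Vs.
exists h => // r /andP[sr rh]; apply: H => //=.
by rewrite ltr_distl; apply/andP; split; lra.
Qed.

Lemma side_left V f x s (l : R) : 0 < s -> V y @[y --> s^'-] --> l -> side f x l ->
  left_side V f x s.
Proof.
move=> s0 Vl fl; suff [h h0 H] : exists2 h, (0 < h)%R &
    forall r, (s - h < r < s)%R -> side f x (V r).
  exists (Num.min h s); first by rewrite lt_min h0 s0 ge_min lexx orbT.
  move=> r /andP[sr rs]; apply: H; rewrite rs andbT (le_lt_trans _ sr)//.
  by rewrite lerD2l lerN2 ge_min lexx.
case: f fl => /= fl.
  have /cvgr_lt /(_ _ fl) [h /= h0 H] := Vl.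
  exists h => // r /andP[sr rs]; apply: H => //=.
  by rewrite ltr_distl; apply/andP; split; lra.
have /cvgr_gt /(_ _ fl) [h /= h0 H] := Vl.
exists h => // r /andP[sr rs]; apply: H => //=.
by rewrite ltr_distl; apply/andP; split; lra.
Qed.

End crossings.

(** * Counting crossings of a fixed level *)

Section counting_R.
Context {R : realType}.
Local Open Scope ereal_scope.

(** Every set of reals is measurable in [discreteR], which makes the counting
    measure additive on arbitrary sets. *)
Definition discreteR := g_sigma_algebraType [set: set R].

Lemma measurable_discreteR (A : set discreteR) : measurable A.
Proof. exact: sub_sigma_algebra. Qed.

Definition countingR : {measure set discreteR -> \bar R} := counting.

Lemma counting_setU (A B : set R) : A `&` B = set0 ->
  counting (A `|` B) = counting A + counting B :> \bar R.
Proof.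
by move=> AB; apply: (measureU countingR) => //; exact: measurable_discreteR.
Qed.

Lemma counting_ge0 (A : set R) : 0 <= counting A :> \bar R.
Proof. exact: (measure_ge0 countingR). Qed.

Lemma counting_le (A B : set R) : A `<=` B -> counting A <= counting B :> \bar R.
Proof.
by move=> AB; apply: (le_measure countingR); rewrite ?inE//; exact: measurable_discreteR.
Qed.

Lemma counting_set0 : counting (@set0 R) = 0 :> \bar R.
Proof. exact: (measure0 countingR). Qed.

Lemma counting_set1 (s : R) : counting [set s] = 1 :> \bar R.
Proof. by rewrite /counting asboolT// fset_set1 cardfs1. Qed.

Lemma finite_counting (A : set R) : counting A < +oo :> \bar R -> finite_set A.
Proof. by rewrite /counting; case: ifPn => [/asboolP//|]; rewrite ltxx. Qed.

Lemma counting_itv_cat (A : set R) a b c : (a <= b)%R -> (b <= c)%R ->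
  counting (A `&` `]a, c]) = counting (A `&` `]a, b]) + counting (A `&` `]b, c]) :> \bar R.
Proof.
move=> ab bc; rewrite -counting_setU; last first.
  rewrite -subset0 => s [[_ /=]]; rewrite in_itv/= => /andP[_ sb] [_ /=].
  by rewrite in_itv/= ltNge sb.
by rewrite -setIUr; congr (counting (_ `&` _)); rewrite -itv_bndbnd_setU.
Qed.

End counting_R.

(** * Balance of upward and downward crossings *)

Section crossing_count.
Context {R : realType} (V : R -> R) (x : R).
Hypothesis Vx : one_sided V x.

Let cnt e c d : \bar R := counting (crossing V e x `&` `]c, d]).
Let sigma e c : R := `[< right_side V e x c >]%:R.

(** The induction property for [cousin]. The sign just to the right of an endpoint, recorded by
    [sigma], stands in for the sign of [V - x] at the endpoint, which may vanish; the identity then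
    telescopes over adjacent intervals. *)
Let P c d := (forall e, cnt e c d < +oo)%E /\
  (forall e, fine (cnt e c d) + sigma e c = fine (cnt (~~ e) c d) + sigma e d).

Let sigmaE e f c : right_side V f x c -> sigma e c = (e == f)%:R.
Proof.
move=> fc; rewrite /sigma; congr (_%:R); congr nat_of_bool.
apply/asboolP/eqP => [ec|->//]; exact: right_side_inj ec fc.
Qed.

Let cnt_fin e c d : (cnt e c d < +oo)%E -> cnt e c d \is a fin_num.
Proof. by move=> ?; rewrite ge0_fin_numE// counting_ge0. Qed.

Let P_cat c d e : c <= d -> d <= e -> P c d -> P d e -> P c e.
Proof.
move=> cd de [fin1 E1] [fin2 E2].
have catE f : cnt f c e = (cnt f c d + cnt f d e)%E by exact: counting_itv_cat.
split=> f; first by rewrite catE lte_add_pinfty.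
rewrite !catE !fineD ?cnt_fin//.
by move: (E1 f) (E2 f) => {}E1 {}E2; lra.
Qed.

Let no_crossing f c d : (forall e r, c < r <= d -> ~ crossing V e x r) ->
  right_side V f x c -> right_side V f x d -> P c d.
Proof.
move=> noc sc sd; have cnt0 e : cnt e c d = 0%E.
  rewrite /cnt (_ : _ `&` _ = set0) ?counting_set0//.
  by apply/seteqP; split=> // r [] cr /=; rewrite in_itv/= => crd; exact: noc crd cr.
by split=> e; rewrite !cnt0// (sigmaE _ sc) (sigmaE _ sd).
Qed.

(** Inside a window of constant sign [f] both sides of [r] carry [f], whereas a crossing needs two
    different signs. *)
Lemma right_crossing f s h r e : (forall r, s < r < s + h -> side f x (V r)) ->
  0 <= s -> s < r < s + h -> ~ crossing V e x r.
Proof.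
move=> H s0 srh [l rr].
have := left_side_inj l (left_side_itv s0 H srh).
have <- := right_side_inj rr (right_side_itv H srh).
by case: e {l rr}.
Qed.

Lemma left_crossing f s h r e : (forall r, s - h < r < s -> side f x (V r)) ->
  0 < h <= s -> s - h < r < s -> ~ crossing V e x r.
Proof.
move=> H /andP[h0 hs]; have -> : s = (s - h) + h by rewrite subrK.
rewrite addrK; apply: right_crossing; last by rewrite subr_ge0.
by move=> q; rewrite subrK; exact: H.
Qed.

Let P_loc s : 0 <= s -> exists2 h, 0 < h & forall c d, 0 <= c -> c <= s ->
     s <= d -> s - h < c -> d < s + h -> P c d.
Proof.
move=> s0; have [f [h h0 Hf]] := Vx.1 _ s0.
have rd d : s <= d -> d < s + h -> right_side V f x d.
  rewrite le_eqVlt => /predU1P[<- _|sd dh]; first by exists h.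
  by apply: (right_side_itv Hf); rewrite sd.
(* At [s = 0] there is no left side, but [0 <= c <= s] forces [c = s]. *)
have [s_eq0|sn0] := eqVneq s 0.
  exists h => // c d c0 cs sd _ dh; have {cs} cs : c = s.
    by apply/eqP; rewrite eq_le cs s_eq0.
  rewrite {c c0}cs.
  apply: (@no_crossing f); [|by exists h|exact: rd].
  move=> e r /andP[sr rd']; apply: (right_crossing Hf) => //.
  by rewrite sr (le_lt_trans rd').
have {sn0 s0}s0 : 0 < s by rewrite lt_neqAle eq_sym sn0.
have [g [k /andP[k0 ks] Hg]] := Vx.2 _ s0.
exists (minr h k) => [|c d c0 cs sd]; first by rewrite lt_min h0.
rewrite ltrBlDl -ltrBlDr lt_min => /andP[_ kc].
rewrite -ltrBlDl lt_min => /andP[dh _].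
rewrite !(ltrBlDl, ltrBlDr) in dh kc.
have noc e r : c < r <= d -> r != s -> ~ crossing V e x r.
  move=> /andP[cr rd']; rewrite neq_lt => /orP[rs|sr].
    apply: (left_crossing Hg); first by rewrite k0.
    by rewrite rs andbT; lra.
  by apply: (right_crossing Hf); [exact: ltW|rewrite sr (le_lt_trans rd')].
(* The interval []c, d]] omits its left end, so a crossing at [s = c] is not counted here. *)
have [c_eq|cns] := eqVneq c s.
  apply: (@no_crossing f); [|by rewrite c_eq; exists h|exact: rd].
  by move=> e r crd; apply: noc => //; rewrite -c_eq gt_eqF//; case/andP: crd.
have {cns cs}cs : c < s by rewrite lt_neqAle cns.
have sc : right_side V g x c by apply: (right_side_itvl Hg); rewrite cs andbT; lra.
(* Only [s] can be a crossing in []c, d]], and it is one exactly when its left sign [g] differs from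
   its right sign [f]. *)
have scr e : crossing V e x s <-> e = f /\ g = ~~ f.
  split=> [[ls rs]|[-> gf]].
    have -> := right_side_inj rs (ex_intro2 _ _ h h0 Hf).
    split => //; apply: (left_side_inj (ex_intro2 _ _ k _ Hg)); first by rewrite k0.
    by have <- := right_side_inj rs (ex_intro2 _ _ h h0 Hf).
  by split; [exists k; rewrite ?k0// -gf|exists h].
have [gf|gf] := eqVneq g (~~ f); last first.
  have {gf}gf : g = f by case: (g) (f) gf => -[].
  apply: (@no_crossing g) => //; last by rewrite gf; exact: rd.
  move=> e r crd; have [->|rs] := eqVneq r s; last exact: noc.
  by move=> /scr[_]; rewrite gf; case: (f).
have cntE e : cnt e c d = ((e == f)%:R)%:E.
  have [ef|ef] := eqVneq e f.
    rewrite /cnt (_ : _ `&` _ = [set s]) ?counting_set1//.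
    apply/seteqP; split=> [r [] cr /=|r ->{r}]; last first.
      by split; [exact/scr|rewrite /= in_itv/= cs].
    by rewrite in_itv/= => crd; apply/eqP; apply: contraPT cr => rs; exact: noc.
  rewrite /cnt (_ : _ `&` _ = set0) ?counting_set0//.
  apply/seteqP; split=> // r [] cr /=; rewrite in_itv/= => crd.
  have [rs|rs] := eqVneq r s; last exact: noc crd rs cr.
  by move: cr; rewrite rs => /scr[] /eqP; rewrite (negbTE ef).
split=> e; rewrite !cntE/= ?ltry//.
rewrite (sigmaE _ sc) (sigmaE _ (rd _ sd dh)) gf.
by case: (e) (f) => -[]; rewrite /= ?eqxx/=; lra.
Qed.

Let P_itv a b : 0 <= a -> a <= b -> P a b.
Proof.
move=> a0 ab; apply: (cousin ab) => [c d e ac cd de _|s /andP[as_ _]].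
  exact: P_cat.
have [h h0 H] := P_loc (le_trans a0 as_); exists h => // c d ac cs sd _.
by apply: H => //; exact: le_trans ac.
Qed.

Lemma counting_crossing_fin e a b : 0 <= a -> a <= b ->
  (counting (crossing V e x `&` `]a, b]) < +oo :> \bar R)%E.
Proof. by move=> a0 ab; have [+ _] := P_itv a0 ab; exact. Qed.

Hypothesis Vrc : forall s, 0 <= s -> V y @[y --> s^'+] --> V s.

(** By right-continuity a strict sign at [c] persists just after [c]. *)
Let sigma_side e c : 0 <= c -> V c != x -> sigma e c = (side e x (V c))%:R.
Proof.
move=> c0 cx; have [f fc] := Vx.1 _ c0.
suff sf : side f x (V c).
  rewrite (sigmaE _ fc); have [->|ef] := eqVneq e f; first by rewrite sf.
  have -> : e = ~~ f by case: (e) (f) ef => -[].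
  by rewrite (sideN sf).
rewrite -[side _ _ _]negbK -side_neq//; apply/negP => nf.
have [h h0 H] := side_right (Vrc c0) nf.
have nfc : right_side V (~~ f) x c by exists h => // r /andP[cr rh]; apply: H; rewrite ltW.
by have := right_side_inj fc nfc; case: (f).
Qed.

(** For [e = false] this is the telescoping identity: upward minus downward crossings equal
    [1_(x < V b) - 1_(x < V a)]. Nothing is subtracted, so the form is symmetric in the two
    directions. *)
Lemma counting_crossing_balance e a b : 0 <= a -> a <= b -> V a != x -> V b != x ->
  fine (counting (crossing V e x `&` `]a, b])) + (side e x (V a))%:R =
  fine (counting (crossing V (~~ e) x `&` `]a, b])) + (side e x (V b))%:R :> R.
Proof.
move=> a0 ab ax bx; have [_ /(_ e)] := P_itv a0 ab.
by rewrite !sigma_side// (le_trans a0).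
Qed.

End crossing_count.

(** * Uniform grids and separation of finite sets *)

Section grid.
Context {R : realType}.
Implicit Types a b : R.

(** The partition of [[a, b]] into [n.+1] (not [n]) equal cells. *)
Definition grid a b n i : R := a + (b - a) * i%:R / n.+1%:R.

Lemma grid0 a b n : grid a b n 0 = a.
Proof. by rewrite /grid mulr0 mul0r addr0. Qed.

Lemma gridn a b n : grid a b n n.+1 = b.
Proof. by rewrite /grid mulfK ?pnatr_eq0// subrKC. Qed.

Lemma gridS a b n i : grid a b n i.+1 - grid a b n i = (b - a) / n.+1%:R.
Proof. by rewrite /grid -[i.+1%:R]natr1; ring. Qed.

Lemma grid_le a b n i j : a <= b -> (i <= j)%N -> grid a b n i <= grid a b n j.
Proof.
move=> ab ij; rewrite lerD2l ler_pM2r ?invr_gt0 ?ltr0n//.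
by rewrite ler_wpM2l ?subr_ge0// ler_nat.
Qed.

Lemma grid_mesh a b h : 0 < h ->
  \forall n \near \oo, forall i, grid a b n i.+1 < grid a b n i + h.
Proof.
move=> h0; have b0 : 0 < h / (`|b - a| + 1) by rewrite divr_gt0// ltr_wpDl.
near=> n => i; rewrite -ltrBlDl gridS.
have : n.+1%:R^-1 < h / (`|b - a| + 1) by near: n; exact: near_infty_natSinv_lt (PosNum b0).
rewrite ltr_pdivlMr ?ltr_wpDl// mulrC; apply: le_lt_trans.
rewrite ler_pM2r ?invr_gt0 ?ltr0n// (le_trans (ler_norm _))// lerDl//.
Unshelve. all: by end_near. Qed.

(** The distances between distinct points form a finite, hence closed, set that misses [0], so a
    ball around [0] misses it too. *)
Lemma finite_separated (C : set R) : finite_set C ->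
  exists2 h, 0 < h & forall r s, C r -> C s -> r != s -> h <= `|r - s|.
Proof.
move=> finC; pose D := [set `|p.1 - p.2| | p in (C `*` C) `&` [set p | p.1 != p.2]].
have clD : closed D.
  apply: (accessible_finite_set_closed.1 (hausdorff_accessible _)).
    exact: norm_hausdorff.
  by apply/finite_image/finite_setIl; exact: finite_setX.
have : open (~` D) by exact: closed_openC.
rewrite openE => /(_ 0)[|h /= h0 hD].
  by case=> p [_ /= p12] /eqP; rewrite normr_eq0 subr_eq0 (negbTE p12).
exists h => // r s Cr Cs rs; rewrite leNgt; apply/negP => rsh.
apply: (hD `|r - s|); first by rewrite /ball_/= sub0r normrN normr_id.
by exists (r, s).
Qed.

End grid.

(** * Crossings counted by grid cells *)

Section cells.
Context {R : realType} (V : R -> R).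

(** The levels passed strictly in direction [e] on the way from [u] to [v]: the open interval
    between them, empty if the move goes the other way. *)
Definition cell e (u v : R) : set R := [set x | side (~~ e) x u && side e x v].

Definition cell_count e a b n x : \bar R :=
  (\sum_(i < n.+1) (\1_(cell e (V (grid a b n i)) (V (grid a b n i.+1))) x)%:E)%E.

Lemma crossing_disj e x : crossing V e x `&` crossing V (~~ e) x = set0.
Proof.
rewrite -subset0 => s [[_ r] [_ r']].
by have := right_side_inj r r'; case: (e).
Qed.

Lemma finite_counting_nat (A : set R) : (counting A < +oo :> \bar R)%E ->
  exists n : nat, counting A = n%:R%:E :> \bar R.
Proof.
by rewrite /counting; case: ifPn; [exists #|` fset_set A|%fset|rewrite ltxx].
Qed.

Variable x : R.
Hypothesis Vx : one_sided V x.
Hypothesis Vrc : forall s, 0 <= s -> V y @[y --> s^'+] --> V s.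

(** Let [u] and [v] be the two counts. With at most one crossing in []p, q]] one has [u + v <= 1],
    and the balance identity fixes [u - v] by the signs at [p] and [q]; together these determine
    [u]. *)
Lemma counting_cell e p q : 0 <= p -> p <= q -> V p != x -> V q != x ->
  (forall r s, (crossing V e x `|` crossing V (~~ e) x) r ->
     (crossing V e x `|` crossing V (~~ e) x) s ->
     p < r <= q -> p < s <= q -> r = s) ->
  counting (crossing V e x `&` `]p, q]) = (\1_(cell e (V p) (V q)) x)%:E :> \bar R.
Proof.
move=> p0 pq px qx one.
have := counting_crossing_balance Vx Vrc e p0 pq px qx.
have [u uE] := finite_counting_nat (counting_crossing_fin Vx e p0 pq).
have [v vE] := finite_counting_nat (counting_crossing_fin Vx (~~ e) p0 pq).
have uv : (u + v <= 1)%N.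
  rewrite -(ler_nat R) natrD -lee_fin EFinD -uE -vE -counting_setU; last first.
    by rewrite setIACA crossing_disj set0I.
  rewrite -setIUl.
  have [->|/set0P[r [Cr]]] := eqVneq ((crossing V e x `|` crossing V (~~ e) x) `&` `]p, q]) set0.
    by rewrite counting_set0 lee_fin.
  rewrite /= in_itv/= => prq; rewrite -(counting_set1 r); apply: counting_le.
  by move=> s [Cs] /=; rewrite in_itv/= => psq; exact: one.
rewrite uE vE /= -!natrD => /eqP; rewrite eqr_nat => /eqP E.
rewrite indicE (_ : (x \in cell e (V p) (V q)) = ~~ side e x (V p) && side e x (V q)); last first.
  by rewrite -side_neq//; apply/idP/idP; rewrite inE.
suff -> : u = (~~ side e x (V p) && side e x (V q))%N by [].
by case: (side e x (V p)) (side e x (V q)) E => -[] /=; lia.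
Qed.

Lemma counting_grid (A : set R) a b n k : a <= b ->
  counting (A `&` `]a, grid a b n k]) =
  (\sum_(i < k) counting (A `&` `](grid a b n i), (grid a b n i.+1)]))%E :> \bar R.
Proof.
move=> ab; elim: k => [|k IH].
  by rewrite big_ord0 grid0 set_itv_ge ?setI0 ?counting_set0// bnd_simp ltxx.
rewrite big_ord_recr/= -IH -counting_itv_cat//; last exact: grid_le.
by rewrite -[leLHS](grid0 a b n) grid_le.
Qed.

(** The crossings in []a, b]] are finitely many, hence separated by some [h]. Once the mesh is below
    [h], each cell contains at most one of them and [counting_cell] applies. *)
Lemma counting_crossing_cells e a b : 0 <= a -> a <= b ->
  (forall n i, V (grid a b n i) != x) ->
  \forall n \near \oo, counting (crossing V e x `&` `]a, b]) = cell_count e a b n x.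
Proof.
move=> a0 ab gx; pose C := (crossing V e x `|` crossing V (~~ e) x) `&` `]a, b].
have finC : finite_set C.
  rewrite /C setIUl finite_setU; split;
    by apply/(@finite_counting R)/counting_crossing_fin.
have [h h0 sepC] := finite_separated finC.
near=> n.
have mesh : forall i, grid a b n i.+1 < grid a b n i + h.
  by near: n; exact: grid_mesh.
rewrite -[in LHS](gridn a b n) counting_grid//; apply: eq_bigr => i _.
have gi j : (j <= n.+1)%N -> a <= grid a b n j <= b.
  move=> jn; apply/andP; split.
    by rewrite -[leLHS](grid0 a b n) grid_le.
  by rewrite -[leRHS](gridn a b n) grid_le.
have [/andP[ai ib] /andP[ai' ib']] := (gi i (ltnW (ltn_ord i)), gi i.+1 (ltn_ord i)).
apply: counting_cell => //; [exact: le_trans ai|exact: grid_le|].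
move=> r s Cr Cs /andP[ir ri] /andP[is_ si]; apply/eqP; apply: contraT => rs.
have : h <= `|r - s|.
  by apply: sepC => //; split => //=; rewrite in_itv/= ?(le_lt_trans ai)//= (le_trans _ ib').
have := mesh i; rewrite leNgt ltr_distl => mi /negP; case.
by apply/andP; split; lra.
Unshelve. all: by end_near. Qed.

End cells.

(** * Almost every level has one-sided signs *)

Section oscillation.
Context {R : realType} (V : R -> R).
Hypothesis Vrc : forall s, 0 <= s -> V y @[y --> s^'+] --> V s.
Implicit Types (x s : R) (e : bool).

Lemma grid_approx (a b h r : R) n : (forall i, grid a b n i.+1 < grid a b n i + h) ->
  0 < h -> a <= r -> r <= b -> exists2 j, (j <= n.+1)%N & r <= grid a b n j < r + h.
Proof.
move=> mesh h0 ar rb.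
have ex : exists j, r <= grid a b n j by exists n.+1; rewrite gridn.
have jn : (ex_minn ex <= n.+1)%N.
  by case: ex_minnP => j _; apply; rewrite gridn.
move: jn; case: ex_minnP => -[|j] rj jmin jn.
  by exists 0%N => //; rewrite rj/= grid0 (le_lt_trans ar)// ltrDl.
exists j.+1 => //; rewrite rj/= (lt_trans (mesh j))// ltrD2r ltNge.
by apply/negP => /jmin; rewrite ltnn.
Qed.

(** A single test [x < V] at both ends, so that the value [x] itself counts as below; this makes the
    discrete intermediate value argument valid for every level. *)
Definition switch x a b n i : bool :=
  (x < V (grid a b n i)) != (x < V (grid a b n i.+1)).

Lemma switch_between x a b n j k : (j <= k)%N ->
  (x < V (grid a b n j)) != (x < V (grid a b n k)) ->
  exists2 i, (j <= i < k)%N & switch x a b n i.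
Proof.
elim: k => [|k IH]; first by rewrite leqn0 => /eqP ->; rewrite eqxx.
rewrite leq_eqVlt => /predU1P[->|]; first by rewrite eqxx.
rewrite ltnS => jk ne; have [sk|sk] := boolP (switch x a b n k).
  by exists k; rewrite ?jk ?leqnn.
have [|i /andP[ji ik] si] := IH jk; first by move: sk; rewrite negbK => /eqP ->.
by exists i => //; rewrite ji ltnW.
Qed.

(** By right-continuity the opposite signs at [r] and [r'] persist for a short time. A fine grid has
    a point in each of the two stretches, hence a switch between them; [r''] leaves room for the
    second point. *)
Lemma switch_window e x a b r r' r'' : 0 <= a ->
  a <= r -> r < r' -> r' < r'' -> r'' <= b ->
  side e x (V r) -> side (~~ e) x (V r') ->
  \forall n \near \oo, exists2 i, (i <= n)%N &
    (r <= grid a b n i) && (grid a b n i < r'') && switch x a b n i.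
Proof.
move=> a0 ar rr' r'r'' r''b er er'.
have r0 := le_trans a0 ar; have r'0 := le_trans r0 (ltW rr').
have [h1 h10 H1] := side_right (Vrc r0) er.
have [h2 h20 H2] := side_right (Vrc r'0) er'.
(* The first two bounds keep the signs at the chosen grid points, [r' - r] puts these points in the
   right order, and [r'' - r'] keeps the second one before [r'']. *)
pose h := minr (minr h1 h2) (minr (r' - r) (r'' - r')).
have h0 : 0 < h by rewrite !lt_min h10 h20 !subr_gt0 rr'.
near=> n.
have mesh : forall i, grid a b n i.+1 < grid a b n i + h.
  by near: n; exact: grid_mesh.
have ab : a <= b by lra.
have [j jn /andP[rj]] : exists2 j, (j <= n.+1)%N & r <= grid a b n j < r + h.
  by apply: grid_approx => //; lra.
have [k kn /andP[rk]] : exists2 j, (j <= n.+1)%N & r' <= grid a b n j < r' + h.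
  by apply: grid_approx => //; lra.
rewrite -!ltrBlDl !lt_min => /andP[/andP[_ kh2] /andP[_ kr'']] /andP[/andP[jh1 _] /andP[jr' _]].
have jk : (j < k)%N.
  by rewrite ltnNge; apply/negP => /(grid_le n ab); lra.
have sj : side e x (V (grid a b n j)) by apply: H1; rewrite rj/=; lra.
have sk : side (~~ e) x (V (grid a b n k)) by apply: H2; rewrite rk/=; lra.
have [|i /andP[ji ik] si] := @switch_between x a b n j k (ltnW jk).
  case: (e) sj sk => /= sj sk; last by rewrite sj ltNge (ltW sk).
  by rewrite sk ltNge (ltW sj).
exists i; first by rewrite -ltnS (leq_trans ik).
rewrite si andbT (le_trans rj) ?grid_le//=.
by rewrite (le_lt_trans (grid_le n ab (ltnW ik)))//; lra.
Unshelve. all: by end_near. Qed.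

(** [Q] selects windows each of which contains a strict change of side and,
    disjoint from it, a smaller window in [Q]. *)
Lemma many_switches (Q : R -> R -> Prop) x a b : 0 <= a ->
  (forall p q, Q p q -> a <= p /\ q <= b) ->
  (forall p q, Q p q -> exists e r r' r'' p' q',
     [/\ Q p' q', q' <= r \/ r'' <= p', side e x (V r), side (~~ e) x (V r') &
       [/\ p <= r, r < r', r' < r'', r'' <= q & p <= p' /\ q' <= q]]) ->
  forall k p q, Q p q -> \forall n \near \oo,
    (k <= \sum_(i < n.+1) [&& (p <= grid a b n i < q)%R & switch x a b n i])%N.
Proof.
move=> a0 Qab HQ; elim=> [p q _|k IH p q Qpq]; first by apply: nearW.
have [ap qb] := Qab _ _ Qpq.
have [e [r [r' [r'' [p' [q' [Q' disj er er' [pr rr' r'r'' r''q [pp' qq']]]]]]]]] := HQ _ _ Qpq.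
near=> n.
have : (k <= \sum_(i < n.+1) [&& (p' <= grid a b n i < q')%R & switch x a b n i])%N.
  by near: n; exact: IH.
have [i] : exists2 i, (i <= n)%N &
    (r <= grid a b n i) && (grid a b n i < r'') && switch x a b n i.
  by near: n; apply: (@switch_window e x a b r r' r'') => //; lra.
rewrite -ltnS => iltn iP; pose i0 : 'I_n.+1 := Ordinal iltn.
have H : (1 <= \sum_(i < n.+1) [&& (r <= grid a b n i < r'')%R & switch x a b n i])%N.
  by rewrite (bigD1 i0)//= iP.
(* The windows [[r, r''[] and [[p', q'[] are disjoint and lie in [[p, q[], so their switch counts
   add up. *)
move=> /(leq_add H); rewrite add1n => /leq_trans; apply.
rewrite -big_split/=; apply: leq_sum => m _.
case: (switch x a b n m); rewrite ?andbF// !andbT.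
set g := grid a b n m.
have [/andP[rg gr]|] := boolP (r <= g < r''); have [/andP[pg gq]|] := boolP (p' <= g < q').
- by case: (disj) => ?; lra.
- by move=> _; rewrite (_ : p <= g < q)//; apply/andP; split; lra.
- by move=> _; rewrite (_ : p <= g < q)//; apply/andP; split; lra.
- by [].
Unshelve. all: by end_near. Qed.

End oscillation.

(** * Strict one-sided signs from bounded switching *)

Section one_sided_signs.
Context {R : realType} (V : R -> R).
Hypothesis Vrc : forall s, 0 <= s -> V y @[y --> s^'+] --> V s.
Implicit Types (x s : R) (e : bool).

(** The values of local extrema: around [r] the function stays weakly on one side of [x = V r]. *)
Definition extremal_value x := exists e (p q r : R),
  [/\ p < r < q, V r = x & forall r', p < r' < q -> ~~ side e x (V r')].

Variables (x T : R).
Hypothesis Vx : ~ extremal_value x.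
Hypothesis bounded_switches : exists k, ~ \forall n \near \oo,
  (k <= \sum_(i < n.+1) switch V x 0 T n i)%N.

(** If side [e] were never taken on []p, q[], a time where side [~~ e] fails would have value [x],
    and [x] would be an extremal value. *)
Let oscillates e p q : ~ (forall r, p < r < q -> side (~~ e) x (V r)) ->
  exists2 r, p < r < q & side e x (V r).
Proof.
move=> nside; apply: contrapT => H; apply: nside => r prq.
have H' r' : p < r' < q -> ~~ side e x (V r').
  by move=> prq'; apply/negP => er'; apply: H; exists r'.
rewrite side_neq ?H'//; apply: contra_notN Vx => /eqP rx.
by exists e, p, q, r.
Qed.

Let bounded_windows (Q : R -> R -> Prop) p q :
  (forall p q, Q p q -> 0 <= p /\ q <= T) ->
  (forall p q, Q p q -> exists e r r' r'' p' q',
     [/\ Q p' q', q' <= r \/ r'' <= p', side e x (V r), side (~~ e) x (V r') &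
       [/\ p <= r, r < r', r' < r'', r'' <= q & p <= p' /\ q' <= q]]) -> ~ Q p q.
Proof.
move=> Q0T HQ Qpq; have [k] := bounded_switches; apply.
have := many_switches Vrc (lexx 0) Q0T HQ k Qpq.
apply: filterS => n /leq_trans; apply; apply: leq_sum => i _.
by case: (_ <= _ < _).
Qed.

Lemma bounded_switches_right s : 0 <= s < T -> exists e, right_side V e x s.
Proof.
move=> /andP[s0 sT]; apply: contrapT => nright.
have osc e q : s < q -> exists2 r, s < r < q & side e x (V r).
  move=> sq; apply: oscillates => H; apply: nright; exists (~~ e), (q - s).
    by rewrite subr_gt0.
  by move=> r; rewrite subrKC; exact: H.
(* Without a right sign every window starting at [s] contains times on both sides of [x]; the
   smaller window runs from [s] to the earlier of two such times. *)
pose Q p q := [/\ p = s, s < q & q <= T].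
apply: (@bounded_windows Q s T); [by move=> _ q [-> _ qT]| |by []].
move=> _ q [-> sq qT].
have [r /andP[sr rq] /= xr] := osc false _ sq.
have [r' /andP[sr' r'q] /= r'x] := osc true _ sq.
have [rr'|r'r|rr'] := ltgtP r r'.
- by exists false, r, r', q, s, r; split => //; [split => //; lra|left|split => //; lra].
- by exists true, r', r, q, s, r'; split => //; [split => //; lra|left|split => //; lra].
- by move: xr r'x; rewrite rr' => /ltW; rewrite leNgt => /negbTE ->.
Qed.

Lemma bounded_switches_left s : 0 < s <= T -> exists e, left_side V e x s.
Proof.
move=> /andP[s0 sT]; apply: contrapT => nleft.
have osc e p : 0 <= p -> p < s -> exists2 r, p < r < s & side e x (V r).
  move=> p0 ps; apply: oscillates => H; apply: nleft; exists (~~ e), (s - p).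
    by rewrite subr_gt0 ps gerBl.
  by move=> r; rewrite subKr; exact: H.
(* The mirror image: windows end at [s], and the smaller one starts midway between the later of the
   two times and [s], a midpoint that also serves as [r'']. *)
pose Q p q := [/\ q = s, 0 <= p & p < s].
apply: (@bounded_windows Q 0 s); [by move=> p _ [-> p0 _]| |by []].
move=> p _ [-> p0 ps].
have [r /andP[pr rs] /= xr] := osc false _ p0 ps.
have [r' /andP[pr' r's] /= r'x] := osc true _ p0 ps.
have [rr'|r'r|rr'] := ltgtP r r'.
- exists false, r, r', ((r' + s) / 2), ((r' + s) / 2), s.
  by split => //; [split => //; lra|right|split => //; lra].
- exists true, r', r, ((r + s) / 2), ((r + s) / 2), s.
  by split => //; [split => //; lra|right|split => //; lra].
- by move: xr r'x; rewrite rr' => /ltW; rewrite leNgt => /negbTE ->.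
Qed.

End one_sided_signs.

(** * Countability of the local extremal values *)

Section countability.
Context {R : realType}.

Lemma countable_subsingleton {T : Type} (A : set T) :
  (forall x y, A x -> A y -> x = y) -> countable A.
Proof.
move=> A1; have [->|/set0P[a Aa]] := eqVneq A set0; first exact: countable0.
by apply: (sub_countable (subset_card_le _) (countable1 a)) => x Ax; exact: A1.
Qed.

Lemma rat_between (p q : R) : p < q -> exists c : rat, p < ratr c < q.
Proof. by move=> /rat_in_itvoo[c]; rewrite in_itv/=; exists c. Qed.

(** The window may be shrunk to rational endpoints. Two extremal values with the same side and the
    same window bound each other both ways, so they coincide. *)
Lemma countable_extremal_value (V : R -> R) : countable (extremal_value V).
Proof.
pose A e (p q : rat) := [set x : R | exists r : R,
  [/\ ratr p < r < ratr q, V r = x &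
      forall r', ratr p < r' < ratr q -> ~~ side e x (V r')]].
apply: (@sub_countable _ _ _ (\bigcup_(e in [set: bool])
   \bigcup_(p in [set: rat]) \bigcup_(q in [set: rat]) A e p q)).
  apply: subset_card_le => x [e [p [q [r [/andP[pr rq] rx H]]]]].
  have [p' /andP[pp' p'r]] := rat_between pr.
  have [q' /andP[rq' q'q]] := rat_between rq.
  exists e => //; exists p' => //; exists q' => //; exists r; split => //.
    by rewrite p'r.
  by move=> r' /andP[p'r' r'q']; apply: H; rewrite (lt_trans pp')//= (lt_trans r'q').
apply: bigcup_countable => // e _; apply: bigcup_countable => // p _.
apply: bigcup_countable => // q _; apply: countable_subsingleton.
move=> x y [r [rpq rx Hr]] [s [spq sy Hs]]; apply/eqP; rewrite eq_le.
have := Hr _ spq; have := Hs _ rpq; rewrite rx sy /side.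
by case: e {Hr Hs}; rewrite -!leNgt => -> ->.
Qed.

End countability.

(** * From Lebesgue measure to its completion *)

Section completed.
Context {R : realType}.
Local Open Scope ereal_scope.

Notation leb := (@lebesgue_measure R).
Notation cleb := (@completed_lebesgue_measure R).
Notation lebT := (caratheodory_type (R := R) (wlength (R := R) idfun)^*%mu).

Lemma measurable_completed (A : set (measurableTypeR R)) :
  measurable A -> measurable (A : set lebT).
Proof. by move=> mA; exact: sub_caratheodory. Qed.

Lemma measurable_fun_completed (D : set (measurableTypeR R))
    (f : measurableTypeR R -> \bar R) :
  measurable D -> measurable_fun D f -> @measurable_fun _ _ lebT _ D f.
Proof. by move=> mD mf _ B mB; apply: measurable_completed; exact: mf. Qed.

(** The identity from the completed to the Borel sigma-algebra is measurable and pushes the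
    completed measure forward to Lebesgue measure. *)
Lemma ge0_integral_completed (D : set (measurableTypeR R)) (f : measurableTypeR R -> \bar R) :
  measurable D -> measurable_fun D f -> (forall x, D x -> 0 <= f x) ->
  \int[cleb]_(x in D) f x = \int[leb]_(x in D) f x.
Proof.
move=> mD mf f0.
have mid : measurable_fun setT (idfun : lebT -> measurableTypeR R).
  by move=> _ B mB; rewrite setTI; exact: measurable_completed.
rewrite -(@ge0_integral_pushforward _ _ lebT (measurableTypeR R) R _ mid cleb D f mD mf)//.
by move=> x /[!inE]; exact: f0.
Qed.

Lemma ae_completed (P : set R) : {ae leb, forall x, P x} -> {ae cleb, forall x, P x}.
Proof.
by move=> [A [mA A0 PA]]; exists A; split => //; exact: measurable_completed.
Qed.

Lemma ae_countable (A : set R) : countable A -> {ae leb, forall x, ~ A x}.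
Proof.
move=> cA; suff : leb.-negligible A.
  by apply: negligibleS => x /= /contrapT.
apply/negligibleP; first exact: countable_measurable.
exact: countable_lebesgue_measure0.
Qed.

End completed.

(** * Cell counts and total variation *)

Section variation_count.
Context {R : realType} (V : R -> R).
Local Open Scope ereal_scope.

Notation leb := (@lebesgue_measure R).

Lemma cellE e (p q : R) : cell e p q =
  if e then `]q, p[%classic else `]p, q[%classic.
Proof.
by rewrite /cell; case: e; apply/seteqP; split=> x /=; rewrite in_itv/= // andbC.
Qed.

Lemma measurable_cell e (p q : R) : measurable (cell e p q : set (measurableTypeR R)).
Proof. by rewrite cellE; case: e; exact: measurable_itv. Qed.

(** The sign [(-1) ^+ e] selects the positive part of the increment for upward moves and the
    negative part for downward ones. *)
Lemma lebesgue_cell e (p q : R) :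
  leb (cell e p q) = (Num.max ((-1) ^+ e * (q - p)) 0)%:E.
Proof.
rewrite cellE; case: e; rewrite lebesgue_measure_itv/= lte_fin/= ?expr0 ?expr1.
  rewrite mulN1r opprB; case: ltP => h; rewrite -?EFinB; congr EFin.
    by rewrite max_l// subr_ge0 ltW.
  by rewrite max_r// subr_le0.
rewrite mul1r; case: ltP => h; rewrite -?EFinB; congr EFin.
  by rewrite max_l// subr_ge0 ltW.
by rewrite max_r// subr_le0.
Qed.

Lemma measurable_cell_count e a b n :
  @measurable_fun _ _ (measurableTypeR R) _ setT (cell_count V e a b n).
Proof.
apply: emeasurable_sum => i; apply/measurable_EFinP.
by apply: measurable_indic; exact: measurable_cell.
Qed.

Lemma cell_count_ge0 e a b n x : 0 <= cell_count V e a b n x.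
Proof. by apply: sume_ge0 => i _; rewrite lee_fin. Qed.

Definition switch_count a b n x : \bar R :=
  cell_count V false a b n x + cell_count V true a b n x.

Lemma measurable_switch_count a b n :
  @measurable_fun _ _ (measurableTypeR R) _ setT (switch_count a b n).
Proof. by apply: emeasurable_funD; exact: measurable_cell_count. Qed.

Lemma switch_count_ge0 a b n x : 0 <= switch_count a b n x.
Proof. by rewrite adde_ge0// cell_count_ge0. Qed.

Lemma integral_cell_count e a b n : \int[leb]_x cell_count V e a b n x =
  (\sum_(i < n.+1) Num.max ((-1) ^+ e * (V (grid a b n i.+1) - V (grid a b n i))) 0)%:E.
Proof.
rewrite ge0_integral_sum//; last first.
  by move=> i; apply/measurable_EFinP/measurable_indic; exact: measurable_cell.
rewrite -sumEFin; apply: eq_bigr => i _.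
rewrite integral_indic//; [rewrite setIT; exact: lebesgue_cell|]. exact: measurable_cell.
Qed.

Lemma sum_le_total_variation a b n k : (a <= b)%R ->
  (\sum_(i < k) `|V (grid a b n i.+1) - V (grid a b n i)|)%:E <=
  total_variation a (grid a b n k) V.
Proof.
move=> ab; have ag i : (a <= grid a b n i)%R.
  by rewrite -[leLHS](grid0 a b n) grid_le.
elim: k => [|k IH]; first by rewrite big_ord0 total_variation_ge0.
rewrite big_ord_recr/= EFinD (@total_variationD _ _ _ (grid a b n k))//; last exact: grid_le.
by rewrite leeD// total_variation_ge// grid_le.
Qed.

(** Positive and negative parts of an increment add up to its absolute value, so the integral is the
    variation of [V] along the grid. *)
Lemma integral_switch_count a b n : (a <= b)%R ->
  \int[leb]_x switch_count a b n x <= total_variation a b V.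
Proof.
move=> ab; rewrite ge0_integralD//; [|by move=> x _; exact: cell_count_ge0|
  exact: measurable_cell_count|by move=> x _; exact: cell_count_ge0|
  exact: measurable_cell_count].
rewrite !integral_cell_count -EFinD -big_split/= -[X in total_variation _ X _](gridn a b n).
apply: le_trans (sum_le_total_variation _ _ ab); rewrite lee_fin; apply: ler_sum => i _.
rewrite expr0 expr1 mul1r mulN1r; set d := (_ - _)%R.
case: (leP 0%R d) => d0.
  by rewrite (max_r (y := 0%R)) ?oppr_le0// addr0 ger0_norm.
by rewrite add0r max_l ?oppr_ge0 ?(ltW d0)// ltr0_norm.
Qed.

End variation_count.

(** * One-sided signs at almost every level *)

Section ae_one_sided.
Context {R : realType} (V : R -> R).
Hypothesis Vrc : forall s, 0 <= s -> V y @[y --> s^'+] --> V s.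
Hypothesis Vbv : forall b, 0 <= b -> bounded_variation 0 b V.

Notation leb := (@lebesgue_measure R).

Definition grid_value a b := [set x : R | exists n i, V (grid a b n i) = x].

Lemma countable_grid_value a b : countable (grid_value a b).
Proof.
rewrite (_ : grid_value a b = \bigcup_(n in [set: nat]) range (fun i => V (grid a b n i))).
  by apply: bigcup_countable => // n _; exact: card_image_le.
apply/seteqP; split=> x; first by move=> [n [i <-]]; exists n => //; exists i.
by move=> [n _ [i _ <-]]; exists n, i.
Qed.

(** Off the grid values the strict tests of [cell] and the single test of [switch] agree. *)
Lemma switch_countE x a b n : ~ grid_value a b x ->
  switch_count V a b n x = (\sum_(i < n.+1) switch V x a b n i)%:R%:E.
Proof.
move=> gx; have {}gx i : V (grid a b n i) != x.
  by apply/eqP => gxi; apply: gx; exists n, i.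
rewrite natr_sum -sumEFin /switch_count -big_split/=; apply: eq_bigr => i _.
rewrite -EFinD; congr EFin; rewrite !indicE /switch -natrD; congr (_%:R).
rewrite (_ : (x \in cell false _ _) = ~~ (x < V (grid a b n i)) && (x < V (grid a b n i.+1))).
  rewrite (_ : (x \in cell true _ _) = (x < V (grid a b n i)) && ~~ (x < V (grid a b n i.+1))).
    by case: (_ < _) (_ < _) => -[].
  by apply/idP/idP; rewrite inE /cell/= -leNgt (lt_neqAle _ x) gx.
by apply/idP/idP; rewrite inE /cell/= -leNgt (lt_neqAle _ x) gx.
Qed.

Local Open Scope ereal_scope.

Definition liminf_switch a b x := limn_einf (switch_count V a b ^~ x).

Lemma measurable_liminf_switch a b :
  @measurable_fun _ _ (measurableTypeR R) (\bar R) setT (liminf_switch a b).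
Proof.
rewrite (_ : liminf_switch a b = fun x => - limn_esup (\- (switch_count V a b ^~ x))).
  apply: measurableT_comp => //.
  apply: (@measurable_fun_limn_esup _ (measurableTypeR R) R setT
     (fun n x => - switch_count V a b n x)) => n.
  by apply: measurableT_comp => //; exact: measurable_switch_count.
by apply/funext => x; rewrite limn_esupN oppeK.
Qed.

Lemma liminf_switch_ge0 a b x : 0 <= liminf_switch a b x.
Proof.
rewrite /liminf_switch limn_einf_lim; apply: lime_ge; first exact: is_cvg_einfs.
by apply: nearW => n; apply: le_ereal_inf_tmp => _ [m _ <-]; exact: switch_count_ge0.
Qed.

Lemma integral_liminf_switch a b : (a <= b)%R ->
  \int[leb]_x liminf_switch a b x <= total_variation a b V.
Proof.
move=> ab; have := @fatou _ (measurableTypeR R) R leb setT measurableT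
  (switch_count V a b) (measurable_switch_count V a b)
  (fun n x _ => switch_count_ge0 V a b n x).
move=> /le_trans; apply; apply: (le_trans (limn_einf_sup _)).
rewrite limn_esup_lim; apply: lime_le; first exact: is_cvg_esups.
apply: nearW => n; apply: ge_ereal_sup => _ [m _ <-]; exact: integral_switch_count.
Qed.

(** By Fatou the liminf of the switch counts has finite integral, so it is finite for almost every
    [x]; counts that eventually exceed every [k] would make it infinite. *)
Lemma ae_one_sided_lt (T : R) : (0 <= T)%R -> {ae leb, forall x,
  exists k, ~ \forall n \near \oo, (k <= \sum_(i < n.+1) switch V x 0 T n i)%N}.
Proof.
move=> T0; have : leb.-integrable setT (liminf_switch 0 T).
  apply/integrableP; split; first exact: measurable_liminf_switch.
  under eq_integral do rewrite gee0_abs ?liminf_switch_ge0//.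
  apply: (le_lt_trans (integral_liminf_switch T0)).
  by have := (bounded_variationP V T0).1 (Vbv T0); rewrite ge0_fin_numE// total_variation_ge0.
move=> /(integrable_ae measurableT); have := ae_countable (countable_grid_value 0 T).
apply: (@filterS2 _ _ (ae_filter_ringOfSetsType leb)) => x gx /(_ I); rewrite ge0_fin_numE ?liminf_switch_ge0// => fx.
apply: contrapT => nk; move: fx; rewrite /liminf_switch.
suff : switch_count V 0 T ^~ x @ \oo --> +oo.
  by move=> /cvg_limn_einf_sup[-> _]; rewrite ltxx.
apply/cvgeyPge => A.
have : \forall n \near \oo, (Num.bound `|A| <= \sum_(i < n.+1) switch V x 0 T n i)%N.
  by apply: contrapT => H; apply: nk; eexists; exact: H.
apply: filterS => n; rewrite -(ler_nat R) switch_countE// lee_fin; apply: le_trans.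
by rewrite (le_trans (ler_norm _))// ltW// archi_boundP.
Qed.

(** The null sets for the integer horizons [m] are united with the countable set of extremal values;
    each time [s] lies below the horizon [Num.bound s]. *)
Lemma ae_one_sided : {ae leb, forall x, one_sided V x}.
Proof.
have H : {ae leb, forall x, forall m : nat, exists k, ~ \forall n \near \oo,
    (k <= \sum_(i < n.+1) switch V x 0%R m%:R n i)%N}.
  by apply/ae_foralln => m; apply: ae_one_sided_lt; exact: ler0n.
have := ae_countable (countable_extremal_value V).
apply: (@filterS2 _ _ (ae_filter_ringOfSetsType leb) _ _ _ _ H) => x Hx ex; split=> s s0.
  by apply: (bounded_switches_right Vrc ex (Hx (Num.bound s))); rewrite s0 archi_boundP.
by apply: (bounded_switches_left Vrc ex (Hx (Num.bound s))); rewrite s0 ltW// archi_boundP// ltW.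
Qed.

End ae_one_sided.

(** * Counting measures of random discrete sets *)

Section random_set.
Context {R : realType} (S : R -> set R).
Local Open Scope ereal_scope.

Notation leb := (@lebesgue_measure R).
Notation cleb := (@completed_lebesgue_measure R).
Notation lebT := (caratheodory_type (R := R) (wlength (R := R) idfun)^*%mu).

Hypothesis Sfin : {ae leb, forall x, forall k : nat,
  counting (S x `&` `](- k%:R)%R, k%:R%R]) < +oo :> \bar R}.
Hypothesis Smeas : forall a b, (a <= b)%R ->
  @measurable_fun _ _ lebT (\bar R) setT (fun x => counting (S x `&` `]a, b])).

Let countS A x : \bar R := counting (S x `&` A).

Lemma counting_nd_cvg (A : set R) (F : (set R)^nat) : nondecreasing_seq F ->
  (counting (A `&` F n) : \bar R) @[n --> \oo] --> (counting (A `&` \bigcup_n F n) : \bar R).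
Proof.
move=> ndF; rewrite setI_bigcupr.
apply: (@nondecreasing_cvg_mu _ (discreteR (R := R)) R countingR) => //.
- by move=> n; exact: measurable_discreteR.
- exact: measurable_discreteR.
- by move=> n m nm; apply/subsetPset; apply: setIS; apply/subsetPset; exact: ndF.
Qed.

(** A monotone class argument from half-open intervals. In the bounded window the counts are finite
    for almost every level, so the count of a proper difference is a difference of counts up to a
    null set, which completeness of [cleb] absorbs. *)
Let measurable_window k B : measurable (B : set (measurableTypeR R)) ->
  @measurable_fun _ _ lebT (\bar R) setT (countS (`](- k%:R)%R, k%:R%R] `&` B)).
Proof.
pose H := [set B : set (measurableTypeR R) |
  @measurable_fun _ _ lebT (\bar R) setT (countS (`](- k%:R)%R, k%:R%R] `&` B))].
move: B; suff : (@measurable _ (measurableTypeR R)) `<=` H by [].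
apply: lambda_system_subset => //.
- exact: ocitvI.
- split => //.
  + by rewrite /H/= setIT; apply: Smeas; have := ler0n R k; lra.
  + move=> A B BA HA HB; rewrite /H/=.
    apply: (@ae_measurable_fun _ lebT R cleb completed_lebesgue_measure_is_complete setT
      (fun x => countS (`](- k%:R)%R, k%:R%R] `&` A) x - countS (`](- k%:R)%R, k%:R%R] `&` B) x)).
      have := ae_completed Sfin; apply: (@filterS _ _ (ae_filter_ringOfSetsType cleb)).
      move=> x /(_ k) fx _.
      have fC C : countS (`](- k%:R)%R, k%:R%R] `&` C) x \is a fin_num.
        rewrite ge0_fin_numE; last exact: counting_ge0.
        by apply: le_lt_trans fx; apply: counting_le; apply: setIS; exact: subIsetl.
      apply/eqP; rewrite sube_eq// ?fin_num_adde_defl//.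
      rewrite /countS -counting_setU; last first.
        by apply/seteqP; split=> // r /= [[_ [_ [_ nB]]] [_ [_ rB]]].
      apply/eqP; congr counting; rewrite -!setIUr; congr (_ `&` (_ `&` _)).
      by rewrite setUC setDUK.
    by apply: (@emeasurable_funB _ lebT R).
  + move=> F ndF HF; rewrite /H/=.
    apply: (@emeasurable_fun_cvg _ lebT R setT
      (fun n => countS (`](- k%:R)%R, k%:R%R] `&` F n))) => // x _.
    rewrite /countS setIA; under eq_fun do rewrite setIA.
    exact: counting_nd_cvg.
- move=> B [[a b] _ <-]; rewrite /H/=.
  rewrite (_ : _ `&` _ = `](Num.max (- k%:R) a)%R, (Num.min k%:R b)%R]%classic); last first.
    apply/seteqP; split=> r /=; rewrite !in_itv/= gt_max le_min.
      by move=> [/andP[-> ->] /andP[-> ->]].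
    by move=> /andP[/andP[-> ->] /andP[-> ->]].
  set c := Num.max _ _; set d := Num.min _ _.
  have [cd|dc] := leP c d; first exact: Smeas.
  rewrite (_ : countS _ = cst 0); first exact: measurable_cst.
  apply/funext => x; rewrite /countS set_itv_ge ?setI0 ?counting_set0//.
  by rewrite bnd_simp -leNgt ltW.
Qed.

Lemma measurable_counting B : measurable (B : set (measurableTypeR R)) ->
  @measurable_fun _ _ lebT (\bar R) setT (fun x => counting (S x `&` B)).
Proof.
move=> mB; apply: (@emeasurable_fun_cvg _ lebT R setT
  (fun k => countS (`](- k%:R)%R, k%:R%R] `&` B))) => [k|x _].
  exact: measurable_window.
rewrite -[X in _ --> counting (_ `&` X)]setTI -(@bigcup_itvT R false false) setI_bigcupl.
apply: (@counting_nd_cvg (S x) (fun k => `](- k%:R)%R, k%:R%R] `&` B)) => m n mn.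
apply/subsetPset; apply: setSI; apply: subset_itv; rewrite bnd_simp ?lerN2 ler_nat//.
Qed.

Definition mean_counting (B : set (measurableTypeR R)) : \bar R :=
  \int[cleb]_x counting (S x `&` B).

Let mean0 : mean_counting set0 = 0.
Proof.
by rewrite /mean_counting; under eq_integral do rewrite setI0 counting_set0; rewrite integral0.
Qed.

Let mean_ge0 B : 0 <= mean_counting B.
Proof. by apply: integral_ge0 => x _; exact: counting_ge0. Qed.

(** Counting is sigma-additive for each [x], and nonnegative series commute with the integral. *)
Let mean_sigma_additive : semi_sigma_additive mean_counting.
Proof.
move=> F mF tF mUF.
rewrite (_ : mean_counting _ = \sum_(n <oo) mean_counting (F n)).
  by apply: is_cvg_nneseries => n _ _; exact: mean_ge0.
rewrite -(@integral_nneseries _ lebT R cleb setT measurableT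
  (fun n x => counting (S x `&` F n))); last 2 first.
  by move=> n; exact: measurable_counting.
  by move=> n x _; exact: counting_ge0.
apply: eq_integral => x _; rewrite setI_bigcupr.
rewrite (@measure_semi_bigcup _ R discreteR countingR)//.
- by move=> *; exact: measurable_discreteR.
- by apply: trivIset_setIl.
- exact: measurable_discreteR.
Qed.

Definition mean_measure : {measure set (measurableTypeR R) -> \bar R} :=
  HB.pack mean_counting (isMeasure.Build _ _ _ mean_counting
    mean0 mean_ge0 mean_sigma_additive).

End random_set.

(** * The crossing measures *)

Lemma limn_near_cst {R : realType} (u : (\bar R)^nat) (l : \bar R) :
  (\forall n \near \oo, l = u n) -> limn_einf u = l /\ limn_esup u = l.
Proof.
move=> H; have : u @ \oo --> l by apply: cvg_near_cst; apply: filterS H => n ->.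
by move=> /cvg_limn_einf_sup[].
Qed.

Section crossing_measure.
Context {R : realType} (V : R -> R).
Hypothesis Vrc : forall s, 0 <= s -> V y @[y --> s^'+] --> V s.
Hypothesis Vbv : forall b, 0 <= b -> bounded_variation 0 b V.
Implicit Types (a b s l u v : R) (e : bool).
Local Open Scope ereal_scope.

Notation leb := (@lebesgue_measure R).
Notation cleb := (@completed_lebesgue_measure R).
Notation lebT := (caratheodory_type (R := R) (wlength (R := R) idfun)^*%mu).

Lemma ae_counting_crossing_fin e : {ae leb, forall x, forall k : nat,
  counting (crossing V e x `&` `](- k%:R)%R, k%:R%R]) < +oo :> \bar R}.
Proof.
have := ae_one_sided Vrc Vbv; apply: (@filterS _ _ (ae_filter_ringOfSetsType leb)).
move=> x Vx k; apply: le_lt_trans (counting_crossing_fin Vx e (lexx 0%R) (ler0n _ k)).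
apply: counting_le => r [cr] /=; rewrite in_itv/= => /andP[_ rk]; split => //=.
by rewrite in_itv/= (crossing_gt0 cr).
Qed.

Lemma ae_good a b : {ae cleb, forall x, one_sided V x /\ ~ grid_value V a b x}.
Proof.
apply: ae_completed; have := ae_countable (countable_grid_value V a b).
have := ae_one_sided Vrc Vbv; apply: (@filterS2 _ _ (ae_filter_ringOfSetsType leb)).
by [].
Qed.

Lemma ae_counting_crossing a b : (0 <= a)%R -> (a <= b)%R ->
  {ae cleb, forall x, one_sided V x /\ forall e, \forall n \near \oo,
    counting (crossing V e x `&` `]a, b]) = cell_count V e a b n x}.
Proof.
move=> a0 ab; have := ae_good a b; apply: (@filterS _ _ (ae_filter_ringOfSetsType cleb)).
move=> x [Vx gx]; split => // e; apply: counting_crossing_cells => // n i.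
by apply/eqP => gi; apply: gx; exists n, i.
Qed.

(** Crossings happen at positive times, so both endpoints may be replaced by their positive parts.
    The count is then almost everywhere a limit of measurable cell counts, which suffices in a
    complete measure space. *)
Lemma measurable_counting_crossing_itv e a b : (a <= b)%R ->
  @measurable_fun _ _ lebT (\bar R) setT (fun x => counting (crossing V e x `&` `]a, b])).
Proof.
move=> ab; pose a' := Num.max a 0%R; pose b' := Num.max b 0%R.
have a'0 : (0 <= a')%R by rewrite le_max lexx orbT.
have ab' : (a' <= b')%R by rewrite ge_max !le_max ab lexx orbT.
have E x : crossing V e x `&` `]a, b] = crossing V e x `&` `]a', b'].
  apply/seteqP; split=> r [cr]; rewrite /= !in_itv/= gt_max le_max => /andP[].
    by move=> -> ->; rewrite (crossing_gt0 cr).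
  move=> /andP[ar r0] /orP[rb|]; first by rewrite ar rb.
  by rewrite leNgt r0.
under eq_fun do rewrite E.
apply: (@ae_measurable_fun _ lebT R cleb completed_lebesgue_measure_is_complete setT
  (fun x => limn_esup (cell_count V e a' b' ^~ x))).
  have := ae_counting_crossing a'0 ab'.
  apply: (@filterS _ _ (ae_filter_ringOfSetsType cleb)) => x [_ /(_ e) nearE] _.
  by have [_] := limn_near_cst nearE.
apply: (@measurable_fun_limn_esup _ lebT R setT (cell_count V e a' b')) => n.
by apply: measurable_fun_completed => //; exact: measurable_cell_count.
Qed.

Definition crossing_measure e := mean_measure (ae_counting_crossing_fin e) (measurable_counting_crossing_itv e).

Lemma crossing_measureE e B : crossing_measure e B =
  \int[cleb]_x counting (crossing V e x `&` B).
Proof. by []. Qed.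

Lemma measurable_counting_crossing e B : measurable (B : set (measurableTypeR R)) ->
  @measurable_fun _ _ lebT (\bar R) setT (fun x => counting (crossing V e x `&` B)).
Proof. by move=> mB; apply: (measurable_counting (ae_counting_crossing_fin e) (measurable_counting_crossing_itv e) mB). Qed.

(** For almost every level both counts eventually equal the cell counts, so their sum is the liminf
    whose integral Fatou bounds. *)
Lemma crossing_measure_le a b : (0 <= a)%R -> (a <= b)%R ->
  crossing_measure false `]a, b]%classic + crossing_measure true `]a, b]%classic <= total_variation a b V.
Proof.
move=> a0 ab; apply: (le_trans _ (integral_liminf_switch V ab)).
rewrite -(@ge0_integral_completed R setT (liminf_switch V a b) measurableT
  (measurable_liminf_switch V a b) (fun x _ => liminf_switch_ge0 V a b x)).
rewrite (crossing_measureE false) (crossing_measureE true).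
rewrite -(@ge0_integralD _ lebT R cleb setT measurableT
  (fun x => counting (crossing V false x `&` `]a, b]))
  (fun x => counting (crossing V true x `&` `]a, b]))
  (fun x _ => counting_ge0 _) (measurable_counting_crossing_itv false ab)
  (fun x _ => counting_ge0 _) (measurable_counting_crossing_itv true ab)).
have mf := @emeasurable_funD _ lebT R setT _ _ (measurable_counting_crossing_itv false ab) (measurable_counting_crossing_itv true ab).
have mg := measurable_fun_completed measurableT (measurable_liminf_switch V a b).
have f0 (x : lebT) : setT x -> 0 <= counting (crossing V false x `&` `]a, b]) +
    counting (crossing V true x `&` `]a, b]) :> \bar R.
  by move=> _; rewrite adde_ge0// counting_ge0.
have g0 (x : lebT) : setT x -> 0 <= liminf_switch V a b x.
  by move=> _; exact: liminf_switch_ge0.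
rewrite (@ge0_ae_eq_integral _ lebT R cleb setT _ _ measurableT mf mg f0 g0); first exact: lexx.
have := ae_counting_crossing a0 ab.
apply: (@filterS _ _ (ae_filter_ringOfSetsType cleb)) => x [_ nearE] _.
apply/esym; apply: (limn_near_cst _).1; near=> n; rewrite /switch_count.
congr (_ + _).
  by near: n; exact: nearE.
by near: n; exact: nearE.
Unshelve. all: by end_near. Qed.

Lemma total_variation_fin a b : (0 <= a)%R -> (a <= b)%R -> total_variation a b V \is a fin_num.
Proof.
move=> a0 ab; apply/(bounded_variationP V ab).
by apply: bounded_variationr (Vbv (le_trans a0 ab)).
Qed.

Lemma crossing_measure_fin e a b : (0 <= a)%R -> (a <= b)%R ->
  crossing_measure e `]a, b]%classic \is a fin_num.
Proof.
move=> a0 ab; rewrite ge0_fin_numE//.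
have := total_variation_fin a0 ab; rewrite ge0_fin_numE ?total_variation_ge0//.
apply: le_lt_trans; apply: (le_trans _ (crossing_measure_le a0 ab)).
by case: e; [rewrite leeDr|rewrite leeDl].
Qed.

Lemma integral_cell_completed e u v :
  \int[cleb]_x (\1_(cell e u v) x)%:E = (Num.max ((-1) ^+ e * (v - u)) 0)%R%:E.
Proof.
rewrite integral_indic//; last first.
  by apply: measurable_completed; exact: measurable_cell.
rewrite setIT; exact: lebesgue_cell.
Qed.

(** The balance identity is integrated over [x]. The indicators of [x < V a] and [x < V b] have
    infinite integral, so the identity is first rewritten with the cells between [V a] and [V b], of
    finite length, one added on each side. *)
Lemma crossing_measure_balance a b : (0 <= a)%R -> (a <= b)%R ->
  (fine (crossing_measure false `]a, b]%classic) - fine (crossing_measure true `]a, b]%classic) =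
   V b - V a)%R.
Proof.
move=> a0 ab.
have mcell e : @measurable_fun _ _ lebT (\bar R) setT
    (fun x => (\1_(cell e (V a) (V b)) x)%:E).
  by apply/measurable_EFinP/measurable_indic/measurable_completed; exact: measurable_cell.
have cell0 e (x : lebT) : setT x -> 0 <= (\1_(cell e (V a) (V b)) x)%:E :> \bar R.
  by rewrite lee_fin.
pose F e x : \bar R := counting (crossing V e x `&` `]a, b]) +
  (\1_(cell (~~ e) (V a) (V b)) x)%:E.
have F0 e (x : lebT) : setT x -> 0 <= F e x.
  by move=> _; rewrite adde_ge0 ?counting_ge0// lee_fin.
have mF e : @measurable_fun _ _ lebT (\bar R) setT (F e).
  exact: (@emeasurable_funD _ lebT R setT _ _ (measurable_counting_crossing_itv e ab) (mcell (~~ e))).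
have intF e : \int[cleb]_x F e x =
    crossing_measure e `]a, b]%classic + (Num.max ((-1) ^+ (~~ e) * (V b - V a)) 0)%R%:E.
  rewrite -integral_cell_completed.
  exact: (@ge0_integralD _ lebT R cleb setT measurableT _ _
    (fun x _ => counting_ge0 _) (measurable_counting_crossing_itv e ab) (cell0 (~~ e)) (mcell (~~ e))).
have : \int[cleb]_x F false x = \int[cleb]_x F true x.
  apply: (@ge0_ae_eq_integral _ lebT R cleb setT _ _ measurableT
    (mF false) (mF true) (F0 false) (F0 true)).
  have := ae_good a b.
  apply: (@filterS _ _ (ae_filter_ringOfSetsType cleb)) => x [Vx gx] _.
  (* For [n = 0] the grid points of index 0 and 1 are [a] and [b], so [V a] and [V b] are grid
     values. *)
  have Va : V a != x.
    by apply/eqP => E; apply: gx; exists 0%N, 0%N; rewrite grid0.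
  have Vb : V b != x.
    by apply/eqP => E; apply: gx; exists 0%N, 1%N; rewrite gridn.
  have := counting_crossing_balance Vx Vrc false a0 ab Va Vb.
  rewrite /F; have [u ->] := finite_counting_nat (counting_crossing_fin Vx false a0 ab).
  have [v ->] := finite_counting_nat (counting_crossing_fin Vx true a0 ab).
  rewrite /= => H; rewrite -!EFinD; congr EFin; rewrite !indicE.
  rewrite (_ : (x \in cell true _ _) = (x < V a)%R && ~~ (x < V b)%R); last first.
    by apply/idP/idP; rewrite inE /cell/= -leNgt (lt_neqAle _ x) Vb.
  rewrite (_ : (x \in cell false _ _) = ~~ (x < V a)%R && (x < V b)%R); last first.
    by apply/idP/idP; rewrite inE /cell/= -leNgt (lt_neqAle _ x) Va.
  by move: H; case: (x < V a)%R (x < V b)%R => -[] /=; lra.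
have [p Ep] : exists p, crossing_measure false `]a, b]%classic = p%:E.
  by eexists; symmetry; apply: fineK; exact: crossing_measure_fin.
have [q Eq] : exists q, crossing_measure true `]a, b]%classic = q%:E.
  by eexists; symmetry; apply: fineK; exact: crossing_measure_fin.
rewrite (intF false) (intF true) Ep Eq -!EFinD => -[]; rewrite expr0 expr1 mul1r mulN1r opprB.
by case: (leP (V b - V a)%R 0%R) => ?; case: (leP (V a - V b)%R 0%R) => ?; rewrite /= => *; lra.
Qed.

(** For [x] other than [l] and [V s], the sign before [s] is that of [l - x] and the sign after it
    that of [V s - x]. So [s] crosses exactly the levels in [cell e l (V s)]. *)
Lemma crossing_measure_set1 e s l : (0 < s)%R -> V y @[y --> s^'-] --> l ->
  crossing_measure e [set s] = (Num.max ((-1) ^+ e * (V s - l)) 0)%R%:E.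
Proof.
move=> s0 Vl; rewrite -integral_cell_completed.
have mcell : @measurable_fun _ _ lebT (\bar R) setT (fun x => (\1_(cell e l (V s)) x)%:E).
  by apply/measurable_EFinP/measurable_indic/measurable_completed; exact: measurable_cell.
have cell0 (x : lebT) : setT x -> 0 <= (\1_(cell e l (V s)) x)%:E :> \bar R.
  by rewrite lee_fin.
have ms : measurable ([set s] : set (measurableTypeR R)) by exact: measurable_set1.
apply: (@ge0_ae_eq_integral _ lebT R cleb setT _ _ measurableT
  (measurable_counting_crossing e ms) mcell (fun x _ => counting_ge0 _) cell0).
have : {ae cleb, forall x, ~ [set l; V s] x}.
  apply/ae_completed/ae_countable/finite_set_countable.
  exact: finite_set2.
apply: (@filterS _ _ (ae_filter_ringOfSetsType cleb)) => x nx _.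
have lx : l != x by apply/eqP => E; apply: nx; left.
have sx : V s != x by apply/eqP => E; apply: nx; right.
have Lf f : side f x l -> left_side V f x s by exact: side_left.
have Rf f : side f x (V s) -> right_side V f x s.
  move=> /(side_right (Vrc (ltW s0)))[h h0 H]; exists h => // r /andP[sr rh].
  by apply: H; rewrite ltW.
have -> : crossing V e x `&` [set s] = if x \in cell e l (V s) then [set s] else set0.
  case: ifPn; rewrite ?inE ?notin_setE => H.
    move: H => /andP[H1 H2].
    apply/seteqP; split=> [r []//|r ->]; split => //; split; [exact: Lf|exact: Rf].
  apply/seteqP; split=> // r [[Lr Rr] rs]; rewrite rs in Lr Rr; apply: H.
  apply/andP; split.
    rewrite -[side _ _ _]negbK -side_neq// negbK; apply/negP => /Lf L.
    by have := left_side_inj L Lr; case: (e).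
  rewrite -[side _ _ _]negbK -side_neq//; apply/negP => /Rf L.
  by have := right_side_inj L Rr; case: (e).
by rewrite indicE; case: ifPn => _; rewrite ?counting_set1 ?counting_set0.
Qed.

End crossing_measure.

(** * Jumps *)

Section jumps.
Context {R : realType}.
Implicit Types (V : R -> R) (x s l : R) (e : bool).

Definition jump_set V : set R := [set s | 0 < s /\ jump V s != 0].

Lemma left_lim_cvg V s : cadlag V -> 0 < s -> V y @[y --> s^'-] --> left_lim V s.
Proof. by move=> [_ HV] /HV[l Vl]; apply/cvg_ex; exists l. Qed.

(** A jump time is determined by its direction, a rational [c] between left limit and value, and a
    rational [p] such that [V] stays on the old side of [c] on []p, s[]: an earlier time with the
    same data would lie in this window on the wrong side. *)
Lemma countable_jump_set V : cadlag V -> countable (jump_set V).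
Proof.
move=> cV.
pose A e (p c : rat) := [set s : R | [/\ ratr p < s, side e (ratr c) (V s) &
  forall r, ratr p < r < s -> side (~~ e) (ratr c) (V r)]].
apply: (@sub_countable _ _ _ (\bigcup_(e in [set: bool])
   \bigcup_(p in [set: rat]) \bigcup_(c in [set: rat]) A e p c)).
  apply: subset_card_le => s [s0 js].
  suff [e [c [ec ec']]] : exists e (c : rat),
      side (~~ e) (ratr c) (left_lim V s) /\ side e (ratr c) (V s).
    have [h /andP[h0 hs] H] := side_left s0 (left_lim_cvg cV s0) ec.
    have [|p /andP[hp ps]] := @rat_between R (s - h) s; first by rewrite gtrBl.
    exists e => //; exists p => //; exists c => //; split => // r /andP[pr rs].
    by apply: H; rewrite (lt_trans hp).
  move: js; rewrite subr_eq0 neq_lt => /orP[/rat_between|/rat_between] [c /andP[c1 c2]].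
    by exists true, c.
  by exists false, c.
apply: bigcup_countable => // e _; apply: bigcup_countable => // p _.
apply: bigcup_countable => // c _; apply: countable_subsingleton => s s'.
move=> [ps es Hs] [ps' es' Hs']; apply/eqP; rewrite eq_le !leNgt; apply/andP; split.
  by apply/negP => s's; have := Hs s'; rewrite ps' s's (sideN es') => /(_ erefl).
by apply/negP => ss'; have := Hs' s; rewrite ps ss' (sideN es) => /(_ erefl).
Qed.

(** A vanishing jump and right-continuity give continuity at [s]. Continuity forces [V s = x], since
    a strict sign of [V s - x] would extend to both sides of [s]. *)
Lemma increases_throughE V x s : cadlag V -> 0 < s ->
  increases_through V x s <-> crossing V false x s /\ jump V s = 0.
Proof.
move=> cV s0; split.
  move=> [Vsx Vc [d d0 H]]; split; last first.
    apply/eqP; rewrite subr_eq0; apply/eqP/esym.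
    apply: cvg_lim => //; have /left_right_continuousP[] := Vc; exact.
  split; [exists (Num.min d s)|exists d => //].
  - by rewrite lt_min d0 s0 ge_min lexx orbT.
  - move=> r /andP[sr rs]; have := H r.
    have mind : Num.min d s <= d by rewrite ge_min lexx.
    have mins : Num.min d s <= s by rewrite ge_min lexx orbT.
    have rs' : r - s < 0 by rewrite subr_lt0.
    rewrite (ltr0_norm rs') (ltr0_sg rs') Vsx => {}H.
    have /eqP : Num.sg (V r - x) = -1 by apply: H; lra.
    by rewrite sgr_cp0 subr_lt0.
  - move=> r /andP[sr rs]; have := H r.
    have rs' : 0 < r - s by rewrite subr_gt0.
    rewrite (gtr0_norm rs') (gtr0_sg rs') Vsx => {}H.
    have /eqP : Num.sg (V r - x) = 1 by apply: H; lra.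
    by rewrite sgr_cp0 subr_gt0.
move=> [[[d /andP[d0 ds] Hl] [h h0 Hr]] /eqP]; rewrite subr_eq0 => /eqP js.
have Vc : {for s, continuous V}.
  apply/left_right_continuousP; split; last exact: (cV.1 _ (ltW s0)).
  by rewrite js; exact: left_lim_cvg.
have nright := fun f => @side_right _ V f x s (cV.1 s (ltW s0)).
have nleft := fun f => @side_left _ V f x s (V s) s0.
have Vl : V y @[y --> s^'-] --> V s by have /left_right_continuousP[] := Vc.
have Vsx : V s = x.
  apply/eqP; rewrite eq_le !leNgt; apply/andP; split; apply/negP => sx.
    have := left_side_inj (nleft false Vl sx) (ex_intro2 _ _ d _ Hl).
    by rewrite d0 => /(_ ds).
  have [k k0 Hk] := nright true sx.
  have kr : right_side V true x s.
    by exists k => // r /andP[sr rk]; apply: Hk; rewrite ltW.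
  by have := right_side_inj kr (ex_intro2 _ _ h h0 Hr).
split=> //; exists (Num.min d h); first by rewrite lt_min d0.
move=> r r0; rewrite lt_min => /andP[rs /andP[rd rh]].
rewrite Vsx; move: rs; rewrite normr_gt0 subr_eq0 neq_lt => /orP[rs|sr].
  have rs' : r - s < 0 by rewrite subr_lt0.
  rewrite (ltr0_sg rs'); apply/eqP; rewrite sgr_cp0 subr_lt0; apply: Hl.
  by rewrite rs andbT; move: rd; rewrite ltr0_norm//; lra.
have rs' : 0 < r - s by rewrite subr_gt0.
rewrite (gtr0_sg rs'); apply/eqP; rewrite sgr_cp0 subr_gt0; apply: Hr.
by rewrite sr; move: rh; rewrite gtr0_norm//; lra.
Qed.

Lemma cadlagN V : cadlag V -> cadlag (fun s => - V s).
Proof.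
move=> [Vr Vl]; split=> s s0; first exact: cvgN (Vr s s0).
by have [l /cvgN] := Vl s s0; exists (- l).
Qed.

Lemma jumpN V s : cadlag V -> 0 < s -> jump (fun s => - V s) s = - jump V s.
Proof.
move=> cV s0; rewrite /jump (_ : left_lim _ s = - left_lim V s); last first.
  by apply: cvg_lim => //; exact: cvgN (left_lim_cvg cV s0).
by rewrite opprK opprB addrC.
Qed.

Lemma crossingN V x s :
  crossing (fun s => - V s) false (- x) s <-> crossing V true x s.
Proof.
split=> -[[d d0 H] [h h0 H']]; split.
- by exists d => // r /H; rewrite /= ltrN2.
- by exists h => // r /H'; rewrite /= ltrN2.
- by exists d => // r /H; rewrite /= ltrN2.
- by exists h => // r /H'; rewrite /= ltrN2.
Qed.

Lemma decreases_throughE V x s : cadlag V -> 0 < s ->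
  decreases_through V x s <-> crossing V true x s /\ jump V s = 0.
Proof.
move=> cV s0; split=> [/(increases_throughE _ (cadlagN cV) s0)|[cr js]].
  rewrite jumpN// => -[/crossingN ? /eqP]; rewrite oppr_eq0 => /eqP; split=> //.
apply/(increases_throughE _ (cadlagN cV) s0); rewrite jumpN// js oppr0.
by split=> //; exact/crossingN.
Qed.

End jumps.

(** * Measures of countable sets *)

Section countable_measure.
Context {R : realType} (mu : {measure set (measurableTypeR R) -> \bar R}).
Local Open Scope ereal_scope.

Lemma measurable_countable (C : set R) : countable C -> measurable (C : set (measurableTypeR R)).
Proof. by apply: countable_measurable => s; exact: measurable_set1. Qed.

(** An injection into the naturals cuts [C] into a sequence of pieces, each empty or a singleton. *)
Lemma measure_countable (C : set R) : countable C ->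
  mu C = \esum_(s in C) mu [set s].
Proof.
move=> cC; have /countable_injP[g ginj] := cC.
pose F i := C `&` g @^-1` [set i].
have FC : C = \bigcup_i F i.
  by apply/seteqP; split=> [s Cs|s [i _ []//]]; exists (g s).
have tF : trivIset setT F.
  by apply/trivIsetP => i j _ _ ij; apply/seteqP; split=> // s [[_ /= gi] [_ /= gj]]; move: ij; rewrite -gi -gj eqxx.
have F1 i : mu (F i) = \esum_(s in F i) mu [set s].
  have [->|/set0P[s Fs]] := eqVneq (F i) set0; first by rewrite measure0 esum_set0.
  suff -> : F i = [set s] by rewrite esum_set1.
  apply/seteqP; split=> [r Fr|r -> //].
  by apply: ginj; [exact: mem_set Fr.1|exact: mem_set Fs.1|rewrite Fr.2 Fs.2].
rewrite {1 2}FC esum_bigcupT// measure_semi_bigcup//.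
- by rewrite nneseries_esumT//; apply: eq_esum => i _; exact: F1.
- move=> i; apply: measurable_countable; apply: sub_countable cC.
  by apply: subset_card_le; exact: subIsetl.
- by rewrite -FC; exact: measurable_countable.
Qed.

End countable_measure.

(** * The variation of the continuous part *)

(** The hypothesis makes [(G + f) / 2] and [(G - f) / 2] nondecreasing; [f] is their difference, and
    their increments add up to that of [G]. *)
Lemma total_variation_le_increment {R : realType} (f G : R -> R) a b : a <= b ->
  (forall c d, a <= c -> c <= d -> d <= b -> `|f d - f c| <= G d - G c) ->
  (total_variation a b f <= (G b - G a)%:E)%E.
Proof.
move=> ab H.
pose g x := (G x + f x) / 2; pose h x := - ((G x - f x) / 2).
have -> : f = g \+ h by apply/funext => x; rewrite /g /h/=; lra.
apply: (le_trans (total_variation_le _ _ ab)).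
rewrite (_ : h = \- (fun x => (G x - f x) / 2)) // total_variationN.
have Hcd c d : c \in `[a, b] -> d \in `[a, b] -> c <= d -> `|f d - f c| <= G d - G c.
  by rewrite !in_itv/= => /andP[ac _] /andP[_ db] cd; exact: H.
rewrite !nondecreasing_total_variation//.
- by rewrite -EFinD lee_fin /g; lra.
- by move=> c d ca db /(Hcd _ _ ca db); rewrite ler_norml => /andP[]; lra.
- by move=> c d ca db /(Hcd _ _ ca db); rewrite ler_norml => /andP[]; rewrite /g; lra.
Qed.

Section decomposition.

Context {R : realType} (V : R -> R) (M : bool -> {measure set (measurableTypeR R) -> \bar R}).
Hypothesis M_fin : forall e a b, 0 <= a -> a <= b -> M e `]a, b]%classic \is a fin_num.
Hypothesis M_le : forall a b, 0 <= a -> a <= b ->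
  (M false `]a, b]%classic + M true `]a, b]%classic <= total_variation a b V)%E.
Hypothesis M_balance : forall a b, 0 <= a -> a <= b ->
  fine (M false `]a, b]%classic) - fine (M true `]a, b]%classic) = V b - V a.
Hypothesis M_jump : forall e s, 0 < s ->
  M e [set s] = (Num.max ((-1) ^+ e * jump V s) 0)%:E.
Hypothesis J_countable : countable (jump_set V).

Implicit Types (E B : set (measurableTypeR R)) (a b c d s : R) (e : bool).

Let J : set (measurableTypeR R) := jump_set V.
Let mJ : measurable J. Proof. exact: measurable_countable. Qed.

Let F e E b : R := fine (M e (`]0, b]%classic `&` E)).

Let F_fin e E a b : measurable E -> 0 <= a -> M e (`]a, b] `&` E) \is a fin_num.
Proof.
move=> mE a0; have [ab|ba] := leP a b; last first.
  by rewrite set_itv_ge ?set0I ?measure0// bnd_simp -leNgt ltW.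
rewrite ge0_fin_numE//; apply: (@le_lt_trans _ _ (M e `]a, b]%classic)).
  by apply: le_measure; rewrite ?inE//; exact: measurableI.
by rewrite -ge0_fin_numE// M_fin.
Qed.

Let F_increment e E a b : measurable E -> 0 <= a -> a <= b ->
  fine (M e (`]a, b] `&` E)) = F e E b - F e E a.
Proof.
move=> mE a0 ab; rewrite /F (_ : `]0, b] `&` E = (`]0, a] `&` E) `|` (`]a, b] `&` E)); last first.
  by rewrite -setIUl -itv_bndbnd_setU.
rewrite measureU; [|exact: measurableI|exact: measurableI|]; last first.
  apply/seteqP; split=> // s [[/= + _] [/= + _]]; rewrite !in_itv/=.
  by move=> /andP[_ sa] /andP[]; rewrite ltNge sa.
by rewrite fineD ?F_fin// addrC addKr.
Qed.

Let F_split e b : 0 <= b -> fine (M e `]0, b]%classic) = F e (~` J) b + F e J b.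
Proof.
move=> b0; have mC := measurableC mJ; rewrite /F -fineD ?F_fin//.
rewrite -measureU; [|exact: measurableI|exact: measurableI|].
  by rewrite -setIUr setUC setUCr setIT.
by rewrite setIACA setICl !setI0.
Qed.

Let F0 e E b : b <= 0 -> F e E b = 0.
Proof. by move=> b0; rewrite /F set_itv_ge ?set0I ?measure0// bnd_simp -leNgt. Qed.

Let F_ge0 e E a b : measurable E -> 0 <= a -> a <= b -> 0 <= F e E b - F e E a.
Proof. by move=> mE a0 ab; rewrite -F_increment// fine_ge0. Qed.

(** The atoms of [M e] are the parts of the jumps in direction [e], and times outside [J] contribute
    zero. Hence the two sums defining [Vdisc] are masses of [J]. *)
Lemma esum_jump e b :
  (\esum_(s in [set s : R | (0 < s <= b)%R]) (Num.max ((-1) ^+ e * jump V s) 0)%:E)%E =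
  M e (`]0, b] `&` J).
Proof.
rewrite measure_countable; last by apply: sub_countable J_countable; apply: subset_card_le; exact: subIsetr.
rewrite esum_mkcondr.
rewrite (_ : [set s : R | (0 < s <= b)%R] = `]0, b]%classic); last first.
  by apply/seteqP; split=> s /=; rewrite in_itv.
apply: eq_esum => s /=; rewrite in_itv/= => /andP[s0 _].
case: ifPn => [_|]; first by rewrite M_jump.
rewrite notin_setE => nJ; suff -> : jump V s = 0 by rewrite mulr0 maxxx.
by apply/eqP; apply: contra_notT nJ => js; split.
Qed.

Lemma VdiscE b : Vdisc V b = F false J b - F true J b.
Proof.
rewrite /F -!esum_jump /Vdisc expr0 expr1.
by congr (fine _ - fine _); apply: eq_esum => s _; rewrite ?mul1r ?mulN1r.
Qed.

Let G e b := F e (~` J) b.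

Lemma VcontE b : 0 <= b -> Vcont V b = V 0 + G false b - G true b.
Proof.
move=> b0; rewrite /Vcont VdiscE; have := M_balance (lexx 0) b0.
by rewrite !F_split// -/(G false b) -/(G true b); lra.
Qed.

(** The upper bound holds because increments of [Vcont V] are differences of increments of [G false]
    and [G true]. For the lower bound let [KK] be the mass on jump times: [M_le] gives [G false + G
    true + KK <= TV(V) <= TV(Vcont V) + TV(Vdisc V)], the last term is at most [KK], and [KK] is
    finite and cancels. *)
Lemma total_variation_Vcont b : 0 <= b ->
  total_variation 0 b (Vcont V) = (G false b + G true b)%:E.
Proof.
have mC := measurableC mJ; move=> b0; apply/eqP; rewrite eq_le; apply/andP; split.
  pose GG s := G false s + G true s.
  rewrite (_ : (G false b + G true b) = GG b - GG 0); last by rewrite /GG /G !(F0 _ _ (lexx 0)); lra.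
  apply: total_variation_le_increment => // c d c0 cd _.
  rewrite !VcontE ?(le_trans c0)// /GG /G.
  have := F_ge0 false mC c0 cd; have := F_ge0 true mC c0 cd => h1 h2.
  by rewrite ler_norml; apply/andP; split; lra.
pose KK s := F false J s + F true J s.
have TVd : (total_variation 0 b (Vdisc V) <= (KK b)%:E)%E.
  rewrite (_ : KK b = KK b - KK 0); last by rewrite /KK !(F0 _ _ (lexx 0)); lra.
  apply: total_variation_le_increment => // c d c0 cd _.
  rewrite !VdiscE /KK.
  have := F_ge0 false mJ c0 cd; have := F_ge0 true mJ c0 cd => h1 h2.
  by rewrite ler_norml; apply/andP; split; lra.
have TVV : (total_variation 0 b V <= total_variation 0 b (Vcont V) + total_variation 0 b (Vdisc V))%E.
  rewrite {1}(_ : V = Vcont V \+ Vdisc V); first exact: total_variation_le.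
  by apply/funext => s; rewrite /Vcont/= subrK.
have := le_trans (M_le (lexx 0) b0) (le_trans TVV (leeD (lexx _) TVd)).
rewrite -(fineK (M_fin false (lexx 0) b0)) -(fineK (M_fin true (lexx 0) b0)) !F_split//.
rewrite -/(G false b) -/(G true b) -leeBlDr//; apply: le_trans.
by rewrite -!EFinD lee_fin /KK; lra.
Qed.

Let maxr0 s : 0 <= Num.max s 0 :> R. Proof. by rewrite le_max lexx orbT. Qed.

Let G_max e s : G e (Num.max s 0) = G e s.
Proof. by have [s0|//] := leP s 0; rewrite /G !F0. Qed.

Lemma TVcontE s : TVcont V s = G false s + G true s.
Proof. by rewrite /TVcont total_variation_Vcont//= !G_max. Qed.

(** [pos_tv] is half the sum of total variation and function, without subtracting the initial value;
    hence the constant [V 0 / 2], which disappears in increments. *)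
Lemma PcontE s : Pcont V s = G false s + V 0 / 2.
Proof.
rewrite /Pcont /pos_tv /neg_tv total_variationN total_variation_Vcont//.
by rewrite [(\- Vcont V) _](_ : _ = - Vcont V (Num.max s 0))// VcontE// !G_max -EFinB -EFinM/=; lra.
Qed.

Lemma NcontE s : Ncont V s = G true s - V 0 / 2.
Proof.
rewrite /Ncont /neg_tv total_variation_Vcont//.
by rewrite VcontE// !G_max -EFinB -EFinM/=; lra.
Qed.

Let D : set (measurableTypeR R) := `]0, +oo[%classic `&` ~` J.
Let mD : measurable D.
Proof. by apply: measurableI; [exact: measurable_itv|exact: measurableC]. Qed.

(** Jump times are removed, and so are times at most [0], because [Pcont], [Ncont] and [TVcont] are
    constant there. *)
Definition continuous_part e : {measure set (measurableTypeR R) -> \bar R} :=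
  mrestr (M e) mD.

Lemma continuous_partE e B : continuous_part e B = M e (B `&` (`]0, +oo[%classic `&` ~` J)).
Proof. by []. Qed.

Lemma continuous_part_itv e a b : a <= b ->
  continuous_part e `]a, b]%classic = (G e b - G e a)%:E.
Proof.
have mC := measurableC mJ; move=> ab; rewrite continuous_partE.
rewrite (_ : _ `&` _ = `](Num.max a 0), (Num.max b 0)]%classic `&` ~` J); last first.
  rewrite setIA; congr (_ `&` _); apply/seteqP; split=> s /=; rewrite !in_itv/= andbT gt_max le_max.
    by move=> [/andP[-> ->] ->].
  by move=> /andP[/andP[-> s0] /orP[->//|]]; rewrite leNgt s0.
have ab' : Num.max a 0 <= Num.max b 0 by rewrite ge_max !le_max ab lexx orbT.
by rewrite -(fineK (F_fin e _ mC (maxr0 a))) F_increment// -!/(G _ _) !G_max.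
Qed.

End decomposition.

(** * Stieltjes measures and occupation sets *)

(** Both sides are the junk value [0] when [S] is infinite. *)
Lemma card_finE {R : realType} (S : set R) : card_fin S = fine (counting S : \bar R).
Proof.
rewrite /card_fin /counting; case: ifPn => [/asboolP finS|/asboolP infS].
  by rewrite fsbig_finite//= big_const_seq count_predT iter_addr_0.
rewrite fsbig_dflt//= => fin; apply: infS; apply: sub_finite_set fin => s Ss.
by split=> //=; apply/eqP; exact: oner_neq0.
Qed.

(** Uniqueness of the extension from half-open intervals. *)
Lemma lebesgue_stieltjes_measureE {R : realType} (f : cumulative R R)
    (mu : {measure set (measurableTypeR R) -> \bar R}) :
  (forall a b, a <= b -> mu `]a, b]%classic = (f b - f a)%:E) ->
  forall B, measurable B -> lebesgue_stieltjes_measure f B = mu B.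
Proof.
move=> muf B mB; apply: lebesgue_stieltjes_measure_unique => // X [[a b] _ <-]/=.
rewrite /lebesgue_stieltjes_measure /measure_extension/=.
rewrite measurable_mu_extE/=; last exact: is_ocitv.
have [ab|ba] := leP a b; last first.
  by rewrite set_itv_ge ?wlength0 ?measure0// bnd_simp -leNgt ltW.
by rewrite wlength_itv_bnd// muf.
Qed.

Section stieltjes.
Context {R : realType} (mu : {measure set (measurableTypeR R) -> \bar R}) (F : R -> R).
Hypothesis muF : forall a b, a <= b -> mu `]a, b]%classic = (F b - F a)%:E.

Let F_nd : nondecreasing F.
Proof. by move=> a b ab; rewrite -subr_ge0 -lee_fin -muF. Qed.

(** Continuity of [mu] from above along []x, x + 1/(n+1)]], whose intersection is empty;
    monotonicity passes from this sequence to all [y > x]. *)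
Let F_rc x : F y @[y --> x^'+] --> F x.
Proof.
pose K n : set (measurableTypeR R) := `]x, x + n.+1%:R^-1]%classic.
have xn n : x <= x + n.+1%:R^-1 by rewrite lerDl invr_ge0.
have : mu \o K @ \oo --> mu (\bigcap_n K n).
  apply: nonincreasing_cvg_mu.
  - by rewrite /K muF ?ltry//.
  - by move=> n; exact: measurable_itv.
  - by apply: bigcapT_measurable => n; exact: measurable_itv.
  - move=> m n mn; apply/subsetPset; apply: subset_itvl.
    by rewrite bnd_simp lerD2l lef_pV2 ?posrE ?ltr0n// ler_nat.
rewrite (_ : \bigcap_n K n = set0) ?measure0; last first.
  apply/seteqP; split=> // y Ky.
  have xy : x < y by have := Ky 0%N I; rewrite /K/= in_itv/= => /andP[].
  have yx : 0 < y - x by rewrite subr_gt0.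
  near \oo => n; have := Ky n I; rewrite /K/= in_itv/= => /andP[_].
  rewrite leNgt => /negP; apply; rewrite -ltrBrDl; near: n.
  exact: near_infty_natSinv_lt (PosNum yx).
move=> muK; apply/cvgrPdist_lt => e e0.
have [n Fn] : exists n, F (x + n.+1%:R^-1) - F x < e.
  have /fine_cvgP[_ /cvgr_lt /(_ e e0) [n _ /(_ n (leqnn _))]] := muK.
  by rewrite /= /K muF// => ?; exists n.
have xn0 : x < x + n.+1%:R^-1 by rewrite ltrDl invr_gt0.
near=> y; have xy : x < y by near: y; exact: nbhs_right_gt.
have yn : y < x + n.+1%:R^-1 by near: y; exact: nbhs_right_lt.
rewrite ler0_norm ?subr_le0; last exact: F_nd (ltW xy).
by rewrite opprB; apply: le_lt_trans Fn; rewrite lerD2r; exact: F_nd (ltW yn).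
Unshelve. all: by end_near. Qed.

(** [F] inherits monotonicity and right-continuity from [mu], so the default zero measure does not
    arise. *)
Lemma LSmeasureE B : measurable B -> LSmeasure F B = mu B.
Proof.
move=> mB; rewrite /LSmeasure; case: pselect => [H|[]]; last by split.
exact: lebesgue_stieltjes_measureE.
Qed.

End stieltjes.

(** On [[0, t]] a function of bounded variation is a difference of two nondecreasing ones. Clamping
    the argument to [[0, t]] by [c] makes them nondecreasing on the whole line, hence Borel. *)
Lemma measurable_occ_set {R : realType} (V : R -> R) (t : R) (A : set (measurableTypeR R)) :
  bounded_variation 0 t V -> 0 < t -> measurable A ->
  measurable (occ_set V t A : set (measurableTypeR R)).
Proof.
move=> bV t0 mA; pose c s := Num.min (Num.max s 0) t.
have c_itv s : c s \in `[0, t].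
  by rewrite in_itv/= /c ge_min lexx orbT andbT le_min (ltW t0) le_max lexx orbT.
have c_nd r s : r <= s -> c r <= c s.
  by move=> rs; rewrite /c le_min !ge_min lexx orbT andbT !ge_max !le_max rs lexx orbT.
have mtv f : bounded_variation 0 t f ->
    measurable_fun [set: R] (fun s => fine (neg_tv 0 f (c s))).
  move=> bf; apply: nondecreasing_measurable => // r s rs.
  exact: (fine_neg_tv_nondecreasing bf (c_itv r) (c_itv s) (c_nd _ _ rs)).
have mW : measurable_fun [set: R]
    (fun s => fine (neg_tv 0 (\- V) (c s)) - fine (neg_tv 0 V (c s))).
  by apply: measurable_funB; apply: mtv => //; exact/bounded_variationN.
rewrite (_ : occ_set V t A = `]0, t]%classic `&`
  ([set: R] `&` (fun s => fine (neg_tv 0 (\- V) (c s)) - fine (neg_tv 0 V (c s))) @^-1` A)).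
  apply: measurableI; first exact: measurable_itv.
  exact: mW.
rewrite setTI; apply/seteqP.
have cE s : 0 < s <= t -> fine (neg_tv 0 (\- V) (c s)) - fine (neg_tv 0 V (c s)) = V s.
  move=> /andP[s0 st]; have cs : c s = s by rewrite /c max_l ?ltW// min_l.
  rewrite cs; have := bounded_variation_pos_neg_tvE bV (x := s).
  by rewrite in_itv/= ltW// st => /(_ isT) ->.
split=> s /=; rewrite in_itv/=.
  by move=> [st As]; split=> //; rewrite cE.
by move=> [st]; rewrite cE.
Qed.

(** * Occupation formulas *)

Section occupation.
Context {R : realType} (V : R -> R) (t : R).
Hypothesis cV : cadlag V.
Hypothesis bV : finite_variation V.
Hypothesis t0 : 0 < t.

Notation leb := (@lebesgue_measure R).
Notation cleb := (@completed_lebesgue_measure R).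
Notation lebT := (caratheodory_type (R := R) (wlength (R := R) idfun)^*%mu).

Definition through e x : set R := if e then Dset V x t else Iset V x t.

(** Writes the passages through [x] as crossings restricted to a Borel set of times independent of
    [x], the form the crossing measures evaluate. *)
Lemma throughE e x : through e x = crossing V e x `&` (`]0, t] `&` ~` jump_set V).
Proof.
have jE s : 0 < s -> jump V s = 0 <-> ~ jump_set V s.
  move=> s0; split=> [js [_]|njs]; first by rewrite js eqxx.
  by apply/eqP; apply: contra_notT njs => js; split.
apply/seteqP; case: e; split=> s /=; rewrite in_itv/=.
- by move=> [/andP[s0 st] /(decreases_throughE _ cV s0)[cs /(jE _ s0)]]; rewrite s0.
- move=> [cs [/andP[s0 st] /(jE _ s0) js]]; split; first by rewrite s0.
  exact/(decreases_throughE _ cV s0).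
- by move=> [/andP[s0 st] /(increases_throughE _ cV s0)[cs /(jE _ s0)]]; rewrite s0.
- move=> [cs [/andP[s0 st] /(jE _ s0) js]]; split; first by rewrite s0.
  exact/(increases_throughE _ cV s0).
Qed.

Lemma through_value e x s : through e x s -> V s = x.
Proof.
case: e => -[_ [Vs _ _]] //.
exact: oppr_inj.
Qed.

Lemma ae_finite_through : {ae leb, forall x, forall e, finite_set (through e x)}.
Proof.
have := ae_one_sided cV.1 bV; apply: (@filterS _ _ (ae_filter_ringOfSetsType leb)).
move=> x Vx e; apply: (@finite_counting R); rewrite throughE.
apply: le_lt_trans (counting_crossing_fin Vx e (lexx 0) (ltW t0)).
by apply: counting_le; apply: setIS; exact: subIsetl.
Qed.

Variable M : bool -> {measure set (measurableTypeR R) -> \bar R}.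
Hypothesis ME : forall e B, M e B = (\int[cleb]_x counting (crossing V e x `&` B))%E.
Hypothesis M_fin : forall e a b, 0 <= a -> a <= b -> M e `]a, b]%classic \is a fin_num.
Hypothesis M_le : forall a b, 0 <= a -> a <= b ->
  (M false `]a, b]%classic + M true `]a, b]%classic <= total_variation a b V)%E.
Hypothesis M_balance : forall a b, 0 <= a -> a <= b ->
  fine (M false `]a, b]%classic) - fine (M true `]a, b]%classic) = V b - V a.
Hypothesis M_jump : forall e s, 0 < s ->
  M e [set s] = (Num.max ((-1) ^+ e * jump V s) 0)%:E.
Hypothesis J_countable : countable (jump_set V).

Let mu e := continuous_part M J_countable e.

Local Open Scope ereal_scope.

Let C e x : \bar R := counting (through e x).

Let mC e : @measurable_fun _ _ lebT (\bar R) setT (C e).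
Proof.
rewrite /C; under eq_fun do rewrite throughE.
apply: (measurable_counting_crossing cV.1 bV); apply: measurableI.
  exact: measurable_itv.
by apply: measurableC; exact: measurable_countable.
Qed.

Let C_ge0 e x : 0 <= C e x. Proof. exact: counting_ge0. Qed.

(** At a crossing without jump [V s = x], so the condition [A (V s)] on times becomes the condition
    [A x] on levels: the count is [C e x] for [x] in [A] and zero otherwise. *)
Let mu_occ e (A : set (measurableTypeR R)) :
  mu e (occ_set V t A) = \int[cleb]_(x in A) C e x.
Proof.
rewrite /mu continuous_partE ME [RHS]integral_mkcond; apply: eq_integral => x _.
rewrite patchE; case: ifPn => xA.
  rewrite inE in xA; rewrite /C; congr counting; rewrite throughE.
  apply/seteqP; split=> s /=; rewrite !in_itv/= andbT.
    by move=> [cs [[st _] [_ nJ]]].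
  move=> [cs [st nJ]]; have /andP[s0 _] := st.
  have Vs : V s = x.
    apply: (@through_value e); rewrite throughE; split.
    by [].
    by split => //=; rewrite in_itv.
  by split => //; split; [split; rewrite ?Vs|].
rewrite notin_setE in xA; rewrite (_ : _ `&` _ = set0) ?counting_set0//.
apply/seteqP; split=> // s [cs [[st As] [_ nJ]]]; apply: xA.
suff <- : V s = x by [].
by apply: (@through_value e); rewrite throughE; split => //; split => //=; rewrite in_itv.
Qed.

Let mu_P a b : (a <= b)%R -> mu false `]a, b]%classic = (Pcont V b - Pcont V a)%:E.
Proof.
move=> ab; rewrite (continuous_part_itv M_fin J_countable false ab) !(PcontE M_fin M_le M_balance M_jump J_countable).
by congr EFin; lra.
Qed.

Let mu_N a b : (a <= b)%R -> mu true `]a, b]%classic = (Ncont V b - Ncont V a)%:E.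
Proof.
move=> ab; rewrite (continuous_part_itv M_fin J_countable true ab) !(NcontE M_fin M_le M_balance M_jump J_countable).
by congr EFin; lra.
Qed.

Let mu_TV a b : (a <= b)%R ->
  measure_add (mu false) (mu true) `]a, b]%classic = (TVcont V b - TVcont V a)%:E.
Proof.
move=> ab; transitivity (mu false `]a, b]%classic + mu true `]a, b]%classic).
  exact: measure_addE.
rewrite (continuous_part_itv M_fin J_countable false ab).
rewrite (continuous_part_itv M_fin J_countable true ab).
rewrite !(TVcontE M_fin M_le M_balance M_jump J_countable) -EFinD.
by congr EFin; lra.
Qed.

Let mocc (A : set (measurableTypeR R)) : measurable A ->
  measurable (occ_set V t A : set (measurableTypeR R)).
Proof. by apply: measurable_occ_set => //; apply: bV; exact: ltW. Qed.

Lemma thetaE (A : set (measurableTypeR R)) : measurable A ->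
  theta V t A = \int[cleb]_(x in A) counting (through false x) -
                \int[cleb]_(x in A) counting (through true x).
Proof.
move=> mA; rewrite /theta (LSmeasureE mu_P (mocc mA)) (LSmeasureE mu_N (mocc mA)).
by rewrite !mu_occ.
Qed.

Lemma varthetaE (A : set (measurableTypeR R)) : measurable A ->
  vartheta V t A = \int[cleb]_(x in A) counting (through false x) +
                   \int[cleb]_(x in A) counting (through true x).
Proof.
move=> mA; rewrite /vartheta (LSmeasureE mu_TV (mocc mA)) -!mu_occ.
exact: measure_addE.
Qed.

(** By [mu_occ] with [A = setT] the integral is a mass inside []0, t]], where [M e] is finite. *)
Lemma integrable_counting_through e : cleb.-integrable setT (fun x => counting (through e x)).
Proof.
apply/integrableP; split; first exact: mC.
under eq_integral do rewrite gee0_abs ?C_ge0//.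
rewrite -/(\int[cleb]_x C e x) -(mu_occ e setT) /mu continuous_partE.
apply: (@le_lt_trans _ _ (M e `]0%R, t]%classic)).
  apply: le_measure; rewrite ?inE.
  - apply: measurableI; first exact: mocc.
    apply: measurableI; first exact: measurable_itv.
    by apply: measurableC; exact: measurable_countable.
  - exact: measurable_itv.
  - by move=> s [[st _] _] /=; rewrite in_itv.
by rewrite -ge0_fin_numE// M_fin// ltW.
Qed.

Lemma measurable_card_through e :
  @measurable_fun _ _ lebT R setT (fun x => card_fin (through e x)).
Proof.
rewrite (_ : (fun x => _) = fine \o C e); last by apply/funext => x; exact: card_finE.
move=> _ B mB; have mfB : measurable (fine @^-1` B : set (\bar R)).
  by rewrite -[X in measurable X]setTI; exact: fine_measurable.
exact: (mC e measurableT mfB).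
Qed.

Lemma integrable_card_through e :
  cleb.-integrable setT (fun x => (card_fin (through e x))%:E).
Proof.
apply: (@le_integrable _ lebT R cleb setT measurableT _ (C e)).
- by apply/measurable_EFinP; exact: measurable_card_through.
- move=> x _; rewrite card_finE !gee0_abs ?C_ge0 ?lee_fin ?fine_ge0 ?C_ge0//.
  by rewrite -/(C e x); case: (C e x) (C_ge0 e x) => //= *; rewrite leey.
- exact: integrable_counting_through.
Qed.

(** [card_fin] and [counting] differ only at levels with infinitely many passages, a null set. *)
Lemma integral_card_through e (A : set (measurableTypeR R)) : measurable A ->
  \int[cleb]_(x in A) (card_fin (through e x))%:E =
  \int[cleb]_(x in A) counting (through e x).
Proof.
move=> mA; have mA' := measurable_completed mA.
have mcard : @measurable_fun _ _ lebT (\bar R) setT (fun x => (card_fin (through e x))%:E).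
  by apply/measurable_EFinP; exact: measurable_card_through.
have sAT : (A : set lebT) `<=` setT by [].
apply: (@ae_eq_integral _ lebT R cleb A _ _ mA'
  (@measurable_funS _ _ lebT (\bar R) setT A _ measurableT sAT mcard)
  (@measurable_funS _ _ lebT (\bar R) setT A _ measurableT sAT (mC e))).
have := ae_completed ae_finite_through.
apply: (@filterS _ _ (ae_filter_ringOfSetsType cleb)) => x fx _.
by rewrite card_finE fineK// /counting asboolT.
Qed.

End occupation.

Theorem theorem1 (R : realType) (V : R -> R) (t : R) :
  cadlag V -> finite_variation V -> 0 < t ->
  [/\ {ae (@lebesgue_measure R), forall x,
         finite_set (Iset V x t) /\ finite_set (Dset V x t)},
      lebesgue_measurable_fun (fun x => ell V x t) /\
      lebesgue_measurable_fun (fun x => lam V x t),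
      (@completed_lebesgue_measure R).-integrable setT (fun x => (ell V x t)%:E) /\
      (@completed_lebesgue_measure R).-integrable setT (fun x => (lam V x t)%:E),
      (forall A : set (measurableTypeR R), measurable A ->
         theta V t A = (\int[@completed_lebesgue_measure R]_(x in A) (ell V x t)%:E)%E) &
      (forall A : set (measurableTypeR R), measurable A ->
         vartheta V t A = (\int[@completed_lebesgue_measure R]_(x in A) (lam V x t)%:E)%E)].
Proof.
move=> cV bV t0.
pose M e := crossing_measure cV.1 bV e.
have ME e B : M e B = (\int[@completed_lebesgue_measure R]_x counting (crossing V e x `&` B))%E.
  by [].
have M_fin e a b : 0 <= a -> a <= b -> M e `]a, b]%classic \is a fin_num.
  exact: crossing_measure_fin.
have M_le a b : 0 <= a -> a <= b ->
    (M false `]a, b]%classic + M true `]a, b]%classic <= total_variation a b V)%E.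
  exact: crossing_measure_le.
have M_balance a b : 0 <= a -> a <= b ->
    fine (M false `]a, b]%classic) - fine (M true `]a, b]%classic) = V b - V a.
  exact: crossing_measure_balance.
have M_jump e s : 0 < s -> M e [set s] = (Num.max ((-1) ^+ e * jump V s) 0)%:E.
  by move=> s0; apply: crossing_measure_set1 => //; exact: left_lim_cvg.
have J_countable := countable_jump_set cV.
(* From here on [M] enters only through the properties just established. *)
clearbody M.
have mc e := measurable_card_through t cV bV J_countable e.
have ic e := integrable_card_through cV bV t0 ME M_fin J_countable e.
have icA e (A : set (measurableTypeR R)) (mA : measurable A) :=
  integrableS measurableT (measurable_completed mA) (@subsetT _ A) (ic e).
have cardE e A := integral_card_through cV bV t0 J_countable e (A := A).
split.
- have := ae_finite_through cV bV t0.
  apply: (@filterS _ _ (ae_filter_ringOfSetsType (@lebesgue_measure R))) => x fx.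
  by split; [exact: (fx false)|exact: (fx true)].
- split; first exact: measurable_funB (mc false) (mc true).
  exact: measurable_funD (mc false) (mc true).
- split; first exact: (integrableB measurableT (ic false) (ic true)).
  exact: (integrableD measurableT (ic false) (ic true)).
- move=> A mA; rewrite (thetaE cV bV t0 ME M_fin M_le M_balance M_jump J_countable mA).
  rewrite -(cardE false A mA) -(cardE true A mA).
  exact/esym/(integralB_EFin (measurable_completed mA) (icA false A mA) (icA true A mA)).
- move=> A mA; rewrite (varthetaE cV bV t0 ME M_fin M_le M_balance M_jump J_countable mA).
  rewrite -(cardE false A mA) -(cardE true A mA).
  exact/esym/(integralD_EFin (measurable_completed mA) (icA false A mA) (icA true A mA)).
Qed.
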